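(* Let $\mu\in\mathcal C$ be a nonzero nilpotent bracket and let $\tilde\mu(t)$ solve the normalised bracket flow $$\tfrac{d}{dt}\tilde\mu=-\pi\big(P_{\tilde\mu}-\alpha_{\tilde\mu}\mathrm{Id}\big)\tilde\mu,\qquad\tilde\mu(0)=\mu/\|\mu\|,\qquad \alpha_{\tilde\mu}:=-\langle\pi(P_{\tilde\mu})\tilde\mu,\tilde\mu\rangle .$$ Then there is an increasing sequence of times $t_l\to\infty$ such that $\tilde\mu(t_l)$ converges, as $l\to\infty$, to a nonzero fixed point of this normalised flow.
   Context: Let $\mathfrak g$ be a real vector space of dimension $2n$ with complex structure $J$ and inner product $\langle\cdot,\cdot\rangle$ for which $J$ is orthogonal; $e_1,\dots,e_{2n}$ an orthonormal basis. A bracket is a skew-symmetric bilinear map $\nu:\mathfrak g\times\mathfrak g\to\mathfrak g$, identified with a linear map $\Lambda^2\mathfrak g\to\mathfrak g$; $\Lambda^2\mathfrak g$ carries the inner product $\langle v_1\wedge v_2,w_1\wedge w_2\rangle=\det(\langle v_i,w_j\rangle)$; brackets carry the inner product $\langle\nu,\eta\rangle=\sum_{i<j}\langle\nu(e_i,e_j),\eta(e_i,e_j)\rangle$ and norm $\|\cdot\|$. $\mathcal C$ is the set of brackets satisfying the Jacobi identity and $\nu(J\cdot,\cdot)=J\nu(\cdot,\cdot)$. For $A\in\mathrm{End}(\mathfrak g)$, $\pi(A)\nu=A\nu(\cdot,\cdot)-\nu(A\cdot,\cdot)-\nu(\cdot,A\cdot)$. $P_\nu:=\nu\nu^*$, i.e.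 $P_\nu v=\sum_{i<j}\langle v,\nu(e_i,e_j)\rangle\nu(e_i,e_j)$. *)

(* Defs.v *)
From HB Require Import structures.
From mathcomp Require Import all_boot all_order all_algebra.
From mathcomp Require Import all_classical all_reals all_analysis.
Set Implicit Arguments. Unset Strict Implicit. Unset Printing Implicit Defensive.
Import Order.TTheory GRing.Theory Num.Theory.
Local Open Scope ring_scope.

(* g = R^N (N = 2n) with the orthonormal basis e_0..e_{N-1}; vectors are
   coordinate functions, endomorphisms are matrices acting on coordinates:
   (A x)_k = \sum_l A k l * x l, so A e_i = \sum_l A l i e_l. *)
Definition vec (R : realType) (N : nat) := 'I_N -> R.

(* A bracket nu is given by its structure constants:
   c i j k = < nu(e_i, e_j), e_k >. *)
Definition bracket (R : realType) (N : nat) := 'I_N -> 'I_N -> 'I_N -> R.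

Definition bzero (R : realType) (N : nat) : bracket R N := fun _ _ _ => 0.

Definition bscale (R : realType) (N : nat) (r : R) (c : bracket R N) : bracket R N :=
  fun i j k => r * c i j k.

Definition brapp (R : realType) (N : nat) (c : bracket R N) (x y : vec R N) : vec R N :=
  fun k => \sum_(i < N) \sum_(j < N) x i * y j * c i j k.

Definition mxapp (R : realType) (N : nat) (A : 'M[R]_N) (x : vec R N) : vec R N :=
  fun k => \sum_(l < N) A k l * x l.

Definition skew (R : realType) (N : nat) (c : bracket R N) :=
  forall i j k, c i j k = - c j i k.

Definition jacobi (R : realType) (N : nat) (c : bracket R N) :=
  forall x y z : vec R N, forall k,
    brapp c (brapp c x y) z k + brapp c (brapp c y z) x k
    + brapp c (brapp c z x) y k = 0.

Definition J_compat (R : realType) (N : nat) (J : 'M[R]_N) (c : bracket R N) :=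
  forall x y : vec R N, forall k, brapp c (mxapp J x) y k = mxapp J (brapp c x y) k.

Definition in_C (R : realType) (N : nat) (J : 'M[R]_N) (c : bracket R N) :=
  [/\ skew c, jacobi c & J_compat J c].

(* right-normed iterated brackets [x_m, [x_{m-1}, ... [x_1, x_0]]];
   these span the m-th term of the lower central series *)
Fixpoint lcs (R : realType) (N : nat) (c : bracket R N) (x : nat -> vec R N) (m : nat)
  : vec R N :=
  match m with
  | 0 => x 0%N
  | m'.+1 => brapp c (x m) (lcs c x m')
  end.

Definition nilpotent (R : realType) (N : nat) (c : bracket R N) :=
  exists m : nat, forall (x : nat -> vec R N) k, lcs c x m k = 0.

(* pi(A) nu = A nu(.,.) - nu(A.,.) - nu(., A.) *)
Definition pi_act (R : realType) (N : nat) (A : 'M[R]_N) (c : bracket R N) : bracket R N :=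
  fun i j k => \sum_(l < N) A k l * c i j l - \sum_(l < N) A l i * c l j k
               - \sum_(l < N) A l j * c i l k.

Definition bdot (R : realType) (N : nat) (c d : bracket R N) : R :=
  \sum_(i < N) \sum_(j < N | (i < j)%N) \sum_(k < N) c i j k * d i j k.

Definition bnorm (R : realType) (N : nat) (c : bracket R N) : R := Num.sqrt (bdot c c).

(* P_nu v = sum_{i<j} <v, nu(e_i,e_j)> nu(e_i,e_j) *)
Definition Pmx (R : realType) (N : nat) (c : bracket R N) : 'M[R]_N :=
  \matrix_(a < N, b < N) \sum_(i < N) \sum_(j < N | (i < j)%N) c i j a * c i j b.

Definition alpha (R : realType) (N : nat) (c : bracket R N) : R :=
  - bdot (pi_act (Pmx c) c) c.

Definition flow_rhs (R : realType) (N : nat) (c : bracket R N) : bracket R N :=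
  fun i j k => - pi_act (Pmx c - (alpha c)%:M) c i j k.

(* Main.v *)
(* Let m(t) be the normalised flow, P = P_m, and let g solve g' = g P with inverse h.
   Then g m(h _, h _) is a positive multiple q(t) of a fixed bracket f, the bracket mu
   written in the basis given by g(0). In the time s with s' = q^2 the Gram matrix
   G = g g^T satisfies dG_kl/ds = tr (f_k G f_l^T G). In a basis adapted to the lower
   central series, with depths d, this system is triangular, so G_kl is a polynomial in s
   of degree at most min (d_k, d_l). As tr P = |m|^2 = 1, Liouville's formula gives
   det G = det G(0) e^(2t), so s tends to infinity with t. Rescaling the k-th basis vector
   by s^(- d_k / 2) makes G converge to a matrix L, which is positive definite because the
   basis vectors of depth 0 generate, and makes f converge to the associated graded
   bracket. On the graded bracket the limit of P acts, up to a factor, as d_k / 2 on the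
   basis vectors of depth d_k; hence pi(P) nu is proportional to nu for every limit point
   nu of m, and nu is a fixed point. *)
Require Import Defs.
From HB Require Import structures.
From mathcomp Require Import all_boot all_order all_algebra.
From mathcomp Require Import all_classical all_reals all_analysis.
From mathcomp Require Import perm ring lra zify.
Import Order.TTheory GRing.Theory Num.Theory.
Import numFieldNormedType.Exports.
Local Open Scope ring_scope.
Local Open Scope classical_set_scope.

Set Implicit Arguments.
Unset Strict Implicit.
Unset Printing Implicit Defensive.

(** * Calculus on the half-line [0, +oo[ *)

Section continuous0y.
Context {R : realType}.

Definition continuous0y {V : normedModType R} (f : R -> V) :=
  {within `[0, +oo[, continuous f}.

Lemma continuous0y_cst {V : normedModType R} (a : V) : continuous0y (fun=> a).
Proof. by move=> t; exact: cvg_cst. Qed.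

Lemma continuous0yN {V : normedModType R} (f : R -> V) :
  continuous0y f -> continuous0y (fun t => - f t).
Proof. by move=> cf t; apply: cvgN; exact: cf. Qed.

Lemma continuous0yB {V : normedModType R} (f g : R -> V) :
  continuous0y f -> continuous0y g -> continuous0y (fun t => f t - g t).
Proof. exact: within_continuousB. Qed.

Lemma continuous0yM (f g : R -> R) :
  continuous0y f -> continuous0y g -> continuous0y (fun t => f t * g t).
Proof. by move=> cf cg t; apply: cvgM; [exact: cf|exact: cg]. Qed.

Lemma continuous0y_sum {V : normedModType R} (I : Type) (r : seq I) (P : pred I)
    (f : I -> R -> V) :
  (forall i, P i -> continuous0y (f i)) ->
  continuous0y (fun t => \sum_(i <- r | P i) f i t).
Proof. by move=> cf; apply: continuous_big => // x; exact: add_continuous. Qed.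

Lemma continuous0y_comp {V : normedModType R} (u : R -> V) (f : R -> R) :
  continuous u -> continuous0y f -> continuous0y (u \o f).
Proof. by move=> cu cf t; apply: cvg_comp (cf t) (cu (f t)). Qed.

Lemma continuous0y_gt0 {V : normedModType R} (f : R -> V) (t : R) :
  continuous0y f -> 0 < t -> {for t, continuous f}.
Proof.
by move=> /continuous_within_itvcyP[cf _] t0; apply: cf; rewrite in_itv/= t0.
Qed.

Lemma continuous0y_within {V : normedModType R} (f : R -> V) (a b : R) :
  continuous0y f -> 0 <= a -> {within `[a, b], continuous f}.
Proof.
move=> cf a0; apply: continuous_subspaceW cf => t /=.
by rewrite !in_itv/= andbT => /andP[/(le_trans a0)].
Qed.

Lemma eq_continuous0y {V : normedModType R} (f g : R -> V) :
  (forall t, 0 <= t -> f t = g t) -> continuous0y f -> continuous0y g.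
Proof.
move=> fg; apply: subspace_eq_continuous => t.
by rewrite inE/= in_itv/= andbT => /fg.
Qed.

Lemma continuous0y_bounded {V : normedModType R} (f : R -> V) (T : R) :
  continuous0y f ->
  exists2 K : R, 0 <= K & forall t, 0 <= t <= T -> `|f t| <= K.
Proof.
move=> cf; have [T0|T0] := leP 0 T; last first.
  by exists 0 => // t /andP[t0 tT]; have := le_trans t0 tT; rewrite leNgt T0.
have [|c _ fc] := @EVT_max R (fun t => `|f t|) _ _ T0.
  apply: continuous0y_within => // t; apply: cvg_norm; exact: cf.
by exists `|f c|.
Qed.

End continuous0y.

Section is_derive0y.
Context {R : realType}.

Definition is_derive0y {V : normedModType R} (f df : R -> V) :=
  continuous0y f /\ forall t : R, 0 < t -> is_derive t 1 f (df t).

Lemma is_derive0y_intro {V : normedModType R} (f df : R -> V) :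
  f @ 0^'+ --> f 0 -> (forall t : R, 0 < t -> is_derive t 1 f (df t)) ->
  is_derive0y f df.
Proof.
move=> f0 hf; split=> //; apply: derivable_oy_Rcontinuous_within_itvcy.
by split=> // t; rewrite in_itv/= andbT => /hf[].
Qed.

Lemma is_derive0y_cst {V : normedModType R} (a : V) :
  is_derive0y (fun=> a) (fun=> 0).
Proof. by split=> [|t _]; [exact: continuous0y_cst|exact: is_derive_cst]. Qed.

Lemma is_derive0y_id : is_derive0y (@id R) (fun=> 1).
Proof.
by split=> [|t _]; [apply: continuous_subspaceT => t; exact: cvg_id|exact: is_derive_id].
Qed.

Lemma eq_is_derive0y {V : normedModType R} (f g df dg : R -> V) :
  (forall t, 0 <= t -> f t = g t) -> (forall t, 0 < t -> df t = dg t) ->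
  is_derive0y f df -> is_derive0y g dg.
Proof.
move=> fg dfg [cf hf]; split=> [|t t0]; first exact: eq_continuous0y cf.
rewrite -dfg//; apply: near_eq_is_derive (hf t t0); near=> s; apply/fg/ltW.
by near: s; exact: lt_nbhsr.
Unshelve. all: by end_near. Qed.

Lemma is_derive0y_eq {V : normedModType R} (f df dg : R -> V) :
  (forall t, 0 < t -> df t = dg t) -> is_derive0y f df -> is_derive0y f dg.
Proof. exact: eq_is_derive0y. Qed.

Lemma is_derive0yD {V : normedModType R} (f g df dg : R -> V) :
  is_derive0y f df -> is_derive0y g dg ->
  is_derive0y (fun t => f t + g t) (fun t => df t + dg t).
Proof.
move=> [cf hf] [cg hg]; split=> [|t t0]; first exact: within_continuousD.
by apply: is_deriveD; [exact: hf|exact: hg].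
Qed.

Lemma is_derive0yN {V : normedModType R} (f df : R -> V) :
  is_derive0y f df -> is_derive0y (fun t => - f t) (fun t => - df t).
Proof.
move=> [cf hf]; split=> [|t t0]; first exact: continuous0yN.
by apply: is_deriveN; exact: hf.
Qed.

Lemma is_derive0yB {V : normedModType R} (f g df dg : R -> V) :
  is_derive0y f df -> is_derive0y g dg ->
  is_derive0y (fun t => f t - g t) (fun t => df t - dg t).
Proof. by move=> hf hg; apply: is_derive0yD hf (is_derive0yN hg). Qed.

Lemma is_derive0yM (f g df dg : R -> R) :
  is_derive0y f df -> is_derive0y g dg ->
  is_derive0y (fun t => f t * g t) (fun t => df t * g t + f t * dg t).
Proof.
move=> [cf hf] [cg hg]; split=> [|t t0]; first exact: continuous0yM.
rewrite addrC [df t * _]mulrC.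
by apply: (@is_deriveM _ _ f g); [exact: hf|exact: hg].
Qed.

Lemma is_derive0y_sum {V : normedModType R} (I : Type) (r : seq I) (P : pred I)
    (f df : I -> R -> V) :
  (forall i, P i -> is_derive0y (f i) (df i)) ->
  is_derive0y (fun t => \sum_(i <- r | P i) f i t)
              (fun t => \sum_(i <- r | P i) df i t).
Proof.
move=> hf; elim: r => [|i r ih].
  by apply: eq_is_derive0y (is_derive0y_cst 0) => t _; rewrite big_nil.
have [Pi|nPi] := boolP (P i).
  by apply: eq_is_derive0y (is_derive0yD (hf i Pi) ih) => t _; rewrite big_cons Pi.
by apply: eq_is_derive0y ih => t _; rewrite big_cons (negbTE nPi).
Qed.

Lemma is_derive0y_comp (u du f df : R -> R) :
  (forall x : R, is_derive x 1 u (du x)) -> is_derive0y f df ->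
  is_derive0y (u \o f) (fun t => du (f t) * df t).
Proof.
move=> hu [cf hf]; split=> [|t t0]; last first.
  by have := hf t t0; have := hu (f t) => huf hft; exact: is_derive1_comp.
apply: continuous0y_comp cf => x; apply/differentiable_continuous/derivable1_diffP.
by have [] := hu x.
Qed.

Lemma is_derive0y_expR (c l : R) :
  is_derive0y (fun t => c * expR (l * t)) (fun t => c * l * expR (l * t)).
Proof.
have hl := is_derive0yM (is_derive0y_cst l) is_derive0y_id.
apply: is_derive0y_eq (is_derive0yM (is_derive0y_cst c)
  (is_derive0y_comp (@is_derive_expR R) hl)) => t _ /=; ring.
Qed.

Lemma ger0_is_derive0y_le (f df : R -> R) (a b : R) : is_derive0y f df ->
  0 <= a -> a <= b -> (forall t, a < t < b -> 0 <= df t) -> f a <= f b.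
Proof.
move=> [cf hf] a0 ab df0; move: ab; rewrite le_eqVlt => /predU1P[->//|ab].
have [||c cab fab] := @MVT R f df a b ab.
- by move=> t /[!in_itv]/= /andP[/(le_lt_trans a0) t0 _]; exact: hf.
- exact: continuous0y_within.
by rewrite -subr_ge0 fab mulr_ge0 ?df0// subr_ge0 ltW.
Qed.

Lemma is_derive0y_0_is_cst (f : R -> R) (t : R) :
  is_derive0y f (fun=> 0) -> 0 <= t -> f t = f 0.
Proof.
move=> hf t0; apply/eqP; rewrite eq_le -[f t <= _]lerN2.
rewrite (ger0_is_derive0y_le hf)//=.
by rewrite (ger0_is_derive0y_le (is_derive0yN hf))// => s; rewrite oppr0.
Qed.

End is_derive0y.

Section primitive.
Context {R : realType}.

Definition prim (f : R -> R) (x : R) : R :=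
  (\int[lebesgue_measure]_(t in `[0, x]) f t)%R.

Lemma prim0 (f : R -> R) : prim f 0 = 0.
Proof. by rewrite /prim set_itv1 Rintegral_set1. Qed.

Lemma is_derive0y_prim (f : R -> R) : continuous0y f -> is_derive0y (prim f) f.
Proof.
move=> cf; have intf T :
    lebesgue_measure.-integrable `[0, T] (EFin \o (f : _ -> measurableTypeR R)).
  apply: continuous_compact_integrable; first exact: segment_compact.
  exact: continuous0y_within.
apply: is_derive0y_intro => [|t t0].
  rewrite prim0; apply: cvg_at_right_filter.
  exact: parameterized_integral_cvg_left ltr01 (intf 1).
have [] := continuous_FTC1_closed (ltr_pwDr ltr01 (lexx t)) (intf (t + 1)) t0 _.
  exact: continuous0y_gt0.
by rewrite derive1E => df dfE; apply: DeriveDef.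
Qed.

Lemma prim_FTC2 (F f : R -> R) (t : R) :
  continuous0y f -> is_derive0y F f -> 0 <= t -> prim f t = F t - F 0.
Proof.
move=> cf hF t0; have hd := is_derive0yB (is_derive0y_prim cf) hF.
have := is_derive0y_0_is_cst (is_derive0y_eq _ hd) t0; rewrite prim0 sub0r.
by move=> <- => [|s _]; [rewrite subrKC|rewrite subrr].
Qed.

Lemma linear_ode_expR (f a : R -> R) (t : R) : continuous0y a ->
  is_derive0y f (fun t => a t * f t) -> 0 <= t -> f t = f 0 * expR (prim a t).
Proof.
move=> ca hf t0.
have hE := is_derive0y_comp (@is_derive_expR R) (is_derive0yN (is_derive0y_prim ca)).
have hfE : is_derive0y (fun t => f t * expR (- prim a t)) (fun=> 0).
  by apply: is_derive0y_eq (is_derive0yM hf hE) => s _ /=; ring.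
have := is_derive0y_0_is_cst hfE t0; rewrite prim0 oppr0 expR0 mulr1 => <-.
by rewrite -mulrA -expRD addNr expR0 mulr1.
Qed.

End primitive.

(** * Matrix-valued functions and linear differential equations *)

Lemma mxtrace_mulmx_tr_eq0 (R : realDomainType) (m n : nat) (A : 'M[R]_(m, n)) :
  \tr (A *m A^T) = 0 -> A = 0.
Proof.
move=> trA; apply/matrixP => i j; rewrite mxE; apply/eqP; rewrite -sqrf_eq0; apply/eqP.
have sq0 k : 0 <= \sum_l A k l ^+ 2 by apply: sumr_ge0 => l _; exact: sqr_ge0.
have trE : \sum_k \sum_l A k l ^+ 2 = 0.
  rewrite -[RHS]trA; apply: eq_bigr => k _; rewrite mxE; apply: eq_bigr => l _.
  by rewrite mxE expr2.
have := psumr_eq0P (fun k _ => sq0 k) trE => /(_ i isT) /psumr_eq0P; apply=> // l _.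
exact: sqr_ge0.
Qed.

Lemma row_gram_eq0 (R : realDomainType) (m n : nat) (x : 'rV[R]_m) (V : 'M[R]_(m, n)) :
  x *m (V *m V^T) *m x^T = 0 -> x *m V = 0.
Proof.
move=> xVx; apply: mxtrace_mulmx_tr_eq0.
by rewrite trmx_mul mulmxA -[_ *m V *m _]mulmxA xVx mxtrace0.
Qed.

Lemma sqr_entry_le_gram (R : realDomainType) (m n : nat) (A : 'M[R]_(m, n)) i j :
  A i j ^+ 2 <= (A *m A^T) i i.
Proof.
rewrite mxE (bigD1 j)//= mxE expr2 lerDl; apply: sumr_ge0 => k _.
by rewrite mxE -expr2 sqr_ge0.
Qed.

Section matrix_limits.
Context {R : realType}.

Lemma le_mx_norm (m n : nat) (A : 'M[R]_(m, n)) i j : `|A i j| <= `|A|.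
Proof.
by rewrite [leRHS]/Num.Def.normr/= mx_normrE; exact: (le_bigmax _ _ (i, j)).
Qed.

Lemma mx_norm_le (m n : nat) (A : 'M[R]_(m, n)) (K : R) :
  0 <= K -> (forall i j, `|A i j| <= K) -> `|A| <= K.
Proof.
move=> K0 AK; rewrite [leLHS]/Num.Def.normr/= mx_normrE.
by apply: bigmax_le => // -[i j] _; exact: AK.
Qed.

Lemma mx_norm_mulmx (m n p : nat) (A : 'M[R]_(m, n)) (B : 'M[R]_(n, p)) :
  `|A *m B| <= n%:R * `|A| * `|B|.
Proof.
apply: mx_norm_le => [|i j]; first by rewrite !mulr_ge0.
rewrite mxE (le_trans (ler_norm_sum _ _ _))//.
apply: le_trans (_ : \sum_(k < n) `|A| * `|B| <= _).
  by apply: ler_sum => k _; rewrite normrM ler_pM ?le_mx_norm.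
by rewrite sumr_const card_ord -[leLHS]mulr_natl mulrA.
Qed.

Lemma cvg_mxP {T : Type} (F : set_system T) {FF : Filter F} (m n : nat)
    (f : T -> 'M[R]_(m, n)) (A : 'M[R]_(m, n)) :
  f @ F --> A <-> forall i j, f x i j @[x --> F] --> A i j.
Proof.
split=> [fA i j|fA].
  apply/cvgrPdist_le => e e0; move/cvgrPdist_le: fA => /(_ e e0).
  by apply: filterS => x; apply: le_trans; have := le_mx_norm (A - f x) i j; rewrite !mxE.
apply/cvgrPdist_le => e e0.
have /filter_forall : forall i, \forall x \near F, forall j, `|A i j - f x i j| <= e.
  move=> i; apply: filter_forall => j.
  by move/cvgrPdist_le: (fA i j) => /(_ e e0).
apply: filterS => x fAx; apply: mx_norm_le (ltW e0) _ => i j; rewrite !mxE.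
exact: fAx.
Qed.

Lemma cvg_sum {V : normedModType R} {T : Type} (F : set_system T) {FF : Filter F}
    (I : Type) (r : seq I) (P : pred I) (f : I -> T -> V) (a : I -> V) :
  (forall i, P i -> f i x @[x --> F] --> a i) ->
  \sum_(i <- r | P i) f i x @[x --> F] --> \sum_(i <- r | P i) a i.
Proof. by move=> fa; apply: cvg_big => // x; exact: add_continuous. Qed.

Lemma cvg_mulmx {T : Type} (F : set_system T) {FF : Filter F} (m n p : nat)
    (f : T -> 'M[R]_(m, n)) (g : T -> 'M[R]_(n, p)) (A : 'M[R]_(m, n)) (B : 'M[R]_(n, p)) :
  f @ F --> A -> g @ F --> B -> f x *m g x @[x --> F] --> A *m B.
Proof.
move=> /cvg_mxP fA /cvg_mxP gB; apply/cvg_mxP => i j; rewrite mxE.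
under eq_cvg do rewrite mxE.
by apply: cvg_sum => k _; apply: cvgM.
Qed.

Lemma cvg_trmx {T : Type} (F : set_system T) {FF : Filter F} (m n : nat)
    (f : T -> 'M[R]_(m, n)) (A : 'M[R]_(m, n)) : f @ F --> A -> (f x)^T @[x --> F] --> A^T.
Proof.
move=> /cvg_mxP fA; apply/cvg_mxP => i j; rewrite mxE.
under eq_cvg do rewrite mxE.
exact: fA.
Qed.

Lemma cvg_mxtrace {T : Type} (F : set_system T) {FF : Filter F} (n : nat)
    (f : T -> 'M[R]_n) (A : 'M[R]_n) : f @ F --> A -> \tr (f x) @[x --> F] --> \tr A.
Proof. by move=> /cvg_mxP fA; apply: cvg_sum. Qed.

End matrix_limits.

Section matrix_derivative.
Context {R : realType}.

Lemma continuous0y_mxP (m n : nat) (F : R -> 'M[R]_(m, n)) :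
  continuous0y F <-> forall i j, continuous0y (fun t => F t i j).
Proof.
split=> [cF i j t|cF t]; first by move: (cF t) => /cvg_mxP; exact.
by apply/cvg_mxP => i j; exact: cF.
Qed.

Lemma is_derive0y_mxP (m n : nat) (F dF : R -> 'M[R]_(m, n)) :
  is_derive0y F dF <->
  forall i j, is_derive0y (fun t => F t i j) (fun t => dF t i j).
Proof.
split=> [[/continuous0y_mxP cF hF] i j|hF].
  split=> // t /hF[dFt <-]; rewrite derive_mx// mxE.
  by apply: DeriveDef => //; move/derivable_mxP: dFt.
split=> [|t t0]; first by apply/continuous0y_mxP => i j; have [] := hF i j.
have dFt : derivable F t 1.
  by apply/derivable_mxP => i j; have [_ /(_ t t0)[]] := hF i j.
apply: DeriveDef => //; rewrite derive_mx//; apply/matrixP => i j; rewrite mxE.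
by have [_ /(_ t t0)[]] := hF i j.
Qed.

Lemma continuous0y_mulmx (m n p : nat) (F : R -> 'M[R]_(m, n)) (G : R -> 'M[R]_(n, p)) :
  continuous0y F -> continuous0y G -> continuous0y (fun t => F t *m G t).
Proof. by move=> cF cG t; apply: cvg_mulmx; [exact: cF|exact: cG]. Qed.

Lemma is_derive0y_mulmx (m n p : nat) (F dF : R -> 'M[R]_(m, n))
    (G dG : R -> 'M[R]_(n, p)) : is_derive0y F dF -> is_derive0y G dG ->
  is_derive0y (fun t => F t *m G t) (fun t => dF t *m G t + F t *m dG t).
Proof.
move=> /is_derive0y_mxP hF /is_derive0y_mxP hG; apply/is_derive0y_mxP => i j.
apply: eq_is_derive0y (is_derive0y_sum (index_enum 'I_n) (P := xpredT)
  (fun k _ => is_derive0yM (hF i k) (hG k j))) => t _; rewrite !mxE//.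
by rewrite big_split.
Qed.

Lemma is_derive0y_trmx (m n : nat) (F dF : R -> 'M[R]_(m, n)) :
  is_derive0y F dF -> is_derive0y (fun t => (F t)^T) (fun t => (dF t)^T).
Proof.
move=> /is_derive0y_mxP hF; apply/is_derive0y_mxP => i j.
by apply: eq_is_derive0y (hF j i) => t _; rewrite mxE.
Qed.

Lemma is_derive0y_scalemx (m n : nat) (f df : R -> R) (F dF : R -> 'M[R]_(m, n)) :
  is_derive0y f df -> is_derive0y F dF ->
  is_derive0y (fun t => f t *: F t) (fun t => df t *: F t + f t *: dF t).
Proof.
move=> hf /is_derive0y_mxP hF; apply/is_derive0y_mxP => i j.
by apply: eq_is_derive0y (is_derive0yM hf (hF i j)) => t _; rewrite !mxE.
Qed.

Lemma is_derive0y_mx_0_is_cst (m n : nat) (F : R -> 'M[R]_(m, n)) (t : R) :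
  is_derive0y F (fun=> 0) -> 0 <= t -> F t = F 0.
Proof.
move=> /is_derive0y_mxP hF t0; apply/matrixP => i j.
apply: (is_derive0y_0_is_cst (f := fun t => F t i j)) => //.
by apply: is_derive0y_eq (hF i j) => s _; rewrite mxE.
Qed.

Lemma is_derive0y_prod (I : eqType) (r : seq I) (f df : I -> R -> R) : uniq r ->
  (forall i, is_derive0y (f i) (df i)) ->
  is_derive0y (fun t => \prod_(i <- r) f i t)
    (fun t => \sum_(i <- r) df i t * \prod_(j <- r | j != i) f j t).
Proof.
move=> + hf; elim: r => [_|i r ih /= /andP[ir /ih{}ih]].
  by apply: eq_is_derive0y (is_derive0y_cst (1 : R)) => t _; rewrite !big_nil.
apply: eq_is_derive0y (is_derive0yM (hf i) ih) => t _; first by rewrite big_cons.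
rewrite !big_cons eqxx/= mulr_sumr; congr (_ * _ + _).
  rewrite big_seq [RHS]big_seq_cond; apply: eq_bigl => j.
  by have [->|] := eqVneq j i; rewrite ?andbT// andbF; apply/negbTE.
rewrite [LHS]big_seq [RHS]big_seq; apply: eq_bigr => j jr; rewrite big_cons mulrCA.
by have [ij|//] := eqVneq i j; rewrite ij jr in ir.
Qed.

Lemma is_derive0y_det (n : nat) (F dF : R -> 'M[R]_n) : is_derive0y F dF ->
  is_derive0y (fun t => \det (F t)) (fun t => \tr (dF t *m \adj (F t))).
Proof.
move=> /is_derive0y_mxP hF.
have hdet := is_derive0y_sum (index_enum 'S_n) (P := xpredT) (fun s _ =>
  is_derive0yM (is_derive0y_cst ((-1) ^+ s : R))
    (is_derive0y_prod (index_enum_uniq 'I_n) (fun i => hF i (s i)))).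
apply: is_derive0y_eq hdet => t _.
transitivity (\sum_i \det (\matrix_(k, l) (if k == i then dF t k l else F t k l))).
  under eq_bigr do rewrite mul0r add0r mulr_sumr.
  rewrite exchange_big/=; apply: eq_bigr => i _; apply: eq_bigr => s _.
  rewrite [in RHS](bigD1 i)//= mxE eqxx; congr (_ * (_ * _)).
  by apply: eq_bigr => j /negbTE ji; rewrite mxE ji.
apply: eq_bigr => i _; rewrite (expand_det_row _ i) mxE; apply: eq_bigr => j _.
rewrite !mxE eqxx; congr (_ * (_ * \det _)); apply/matrixP => k l.
by rewrite !mxE eq_sym (negbTE (neq_lift _ _)).
Qed.

Lemma liouville_det (n : nat) (X A : R -> 'M[R]_n) (t : R) :
  continuous0y A -> is_derive0y X (fun t => X t *m A t) -> 0 <= t ->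
  \det (X t) = \det (X 0) * expR (prim (fun t => \tr (A t)) t).
Proof.
move=> /continuous0y_mxP cA hX.
apply: (@linear_ode_expR _ (fun t => \det (X t))); first exact: continuous0y_sum.
apply: is_derive0y_eq (is_derive0y_det hX) => s _.
by rewrite -mulmxA mxtrace_mulC -mulmxA mul_adj_mx mul_mx_scalar linearZ/= mulrC.
Qed.

End matrix_derivative.

Section uniform_limits.
Context {R : realType}.

Lemma series_norm_le_cvg {V : completeNormedModType R} (u : nat -> V)
    (M : nat -> R) : (forall n, `|u n| <= M n) -> cvgn (series M) ->
  forall n, `|limn (series u) - series u n| <= limn (series M) - series M n.
Proof.
move=> uM cM n; have cu : cvgn (series u).
  by apply: normed_cvg; apply: series_le_cvg cM => k //=; rewrite (le_trans _ (uM k)).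
have cu_n : `|series u k - series u n| @[k --> \oo] --> `|limn (series u) - series u n|.
  by apply: cvg_norm; apply: cvgB => //; exact: cvg_cst.
have cM_n : series M k - series M n @[k --> \oo] --> limn (series M) - series M n.
  by apply: cvgB => //; exact: cvg_cst.
apply: ler_cvg_to cu_n cM_n _; near=> k.
have nk : (n <= k)%N by near: k; exact: nbhs_infty_ge.
rewrite !sub_series_geq// (le_trans (ler_norm_sum _ _ _))//.
exact: ler_sum.
Unshelve. all: by end_near. Qed.

Definition ucvg0y {V : normedModType R} (u : nat -> R -> V) (f : R -> V) :=
  forall T e : R, 0 < e ->
  \forall n \near \oo, forall t, 0 <= t <= T -> `|f t - u n t| <= e.

Lemma ucvg0y_cvg {V : normedModType R} (u : nat -> R -> V) (f : R -> V) (t : R) :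
  ucvg0y u f -> 0 <= t -> u n t @[n --> \oo] --> f t.
Proof.
move=> uf t0; apply/cvgrPdist_le => e e0.
by apply: filterS (uf t e e0) => n; apply; rewrite t0 lexx.
Qed.

Lemma continuous0y_ucvg {V : normedModType R} (u : nat -> R -> V) (f : R -> V) :
  (forall n, continuous0y (u n)) -> ucvg0y u f -> continuous0y f.
Proof.
move=> cu uf; apply/subspace_continuousP => t /=; rewrite in_itv/= andbT => t0.
apply/cvgrPdist_le => e e0; have e30 : 0 < e / 3 by rewrite divr_gt0.
have [n _ /(_ n (leqnn n)) ufn] := uf (t + 1) _ e30.
have /subspace_continuousP/(_ t) := cu n.
rewrite /= in_itv/= andbT => /(_ t0)/cvgrPdist_le/(_ _ e30) cun.
near=> s; have s0 : 0 <= s.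
  by near: s; rewrite near_withinE; apply: nearW => s; rewrite /= in_itv/= andbT.
have st : s < t + 1 by near: s; apply: cvg_within; apply: lt_nbhsl; rewrite ltrDl.
rewrite /from_subspace (_ : e = e / 3 + (e / 3 + e / 3)); last by field.
rewrite (le_trans (ler_distD (u n t) _ _))// lerD ?ufn ?t0 ?lerDl ?ler01//.
rewrite (le_trans (ler_distD (u n s) _ _))// lerD//; first by near: s.
by rewrite distrC ufn// s0 ltW.
Unshelve. all: by end_near. Qed.

End uniform_limits.

HB.instance Definition _ (R : realType) (m n : nat) :=
  Complete.on 'M[R]_(m, n).

Section linear_ode.
Context {R : realType}.

Definition mxprim (m n : nat) (F : R -> 'M[R]_(m, n)) (t : R) : 'M[R]_(m, n) :=
  \matrix_(i, j) prim (fun s => F s i j) t.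

Lemma mxprim0 (m n : nat) (F : R -> 'M[R]_(m, n)) : mxprim F 0 = 0.
Proof. by apply/matrixP => i j; rewrite !mxE prim0. Qed.

Lemma is_derive0y_mxprim (m n : nat) (F : R -> 'M[R]_(m, n)) :
  continuous0y F -> is_derive0y (mxprim F) F.
Proof.
move=> /continuous0y_mxP cF; apply/is_derive0y_mxP => i j.
by apply: eq_is_derive0y (is_derive0y_prim (cF i j)) => t _; rewrite ?mxE.
Qed.

Lemma is_derive0y_mx_dist_le (m n : nat) (F dF : R -> 'M[R]_(m, n)) (g dg : R -> R)
    (T : R) : is_derive0y F dF -> is_derive0y g dg -> 0 <= T ->
  (forall t, 0 < t < T -> `|dF t| <= dg t) -> `|F T - F 0| <= g T - g 0.
Proof.
move=> /is_derive0y_mxP hF hg T0 dFg.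
apply: mx_norm_le => [|i j].
  rewrite subr_ge0 (ger0_is_derive0y_le hg)// => t tT; exact: le_trans (dFg t tT).
have dFijg t : 0 < t < T -> - dg t <= dF t i j <= dg t.
  by move=> /dFg; rewrite -ler_norml; exact/le_trans/le_mx_norm.
rewrite !mxE ler_norml; apply/andP; split.
  have := ger0_is_derive0y_le (is_derive0yD hg (hF i j)) (lexx 0) T0.
  have dge t : 0 < t < T -> 0 <= dg t + dF t i j by move=> /dFijg/andP[]; lra.
  by move=> /(_ dge); lra.
have := ger0_is_derive0y_le (is_derive0yB hg (hF i j)) (lexx 0) T0.
have dge t : 0 < t < T -> 0 <= dg t - dF t i j by move=> /dFijg/andP[]; lra.
by move=> /(_ dge); lra.
Qed.

Lemma is_derive0y_ucvg (m n : nat) (F f : nat -> R -> 'M[R]_(m, n))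
    (G g : R -> 'M[R]_(m, n)) :
  (forall k, is_derive0y (F k) (f k)) -> (forall k, continuous0y (f k)) ->
  ucvg0y f g -> (forall t, 0 <= t -> F k t @[k --> \oo] --> G t) ->
  is_derive0y G g.
Proof.
move=> hF cf fg FG; have cg := continuous0y_ucvg cf fg.
have hg := is_derive0y_mxprim cg.
have hG := is_derive0yD (is_derive0y_cst (G 0)) hg.
apply: eq_is_derive0y hG => t t0; last by rewrite add0r.
apply/eqP; rewrite addrC -subr_eq0 -normr_le0.
have FGt : `|mxprim g t - (F k t - F k 0)| @[k --> \oo] --> `|mxprim g t + G 0 - G t|.
  rewrite -addrA -[G 0 - G t]opprB; apply: cvg_norm.
  apply: cvgB; first exact: cvg_cst.
  by apply: cvgB; exact: FG.
apply/ler_addgt0Pr => e e0; rewrite add0r.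
apply: (cvgr_to_le FGt).
have e1 : 0 < e / (1 + t) by rewrite divr_gt0// ltr_pwDl.
apply: filterS (fg t _ e1) => k fgk.
have he := is_derive0yM (is_derive0y_cst (e / (1 + t))) is_derive0y_id.
have := is_derive0y_mx_dist_le (is_derive0yB hg (hF k)) he t0.
rewrite mxprim0 mulr0 subr0 sub0r opprK -addrA [- _ + _]addrC -[F k 0 - _]opprB.
move=> /(_ _)/le_trans; apply=> [s /andP[s0 st]|].
  by rewrite mul0r add0r mulr1 fgk// !ltW.
by rewrite mulrAC ler_pdivrMr ?ltr_pwDl// ler_wpM2l ?ltW// ltrDr.
Qed.

Lemma ucvg0y_mulmx (m n p : nat) (A : R -> 'M[R]_(m, n))
    (u : nat -> R -> 'M[R]_(n, p)) f :
  continuous0y A -> ucvg0y u f -> ucvg0y (fun k t => A t *m u k t) (fun t => A t *m f t).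
Proof.
move=> cA uf T e e0; have [K K0 AK] := continuous0y_bounded T cA.
have e1 : 0 < e / (1 + n%:R * K) by rewrite divr_gt0// ltr_pwDl// mulr_ge0.
apply: filterS (uf T _ e1) => k ufk t tT; rewrite -mulmxBr.
apply: le_trans (mx_norm_mulmx _ _) _.
apply: le_trans (ler_pM _ (normr_ge0 _) _ (ufk t tT)) _; first exact: mulr_ge0.
  by apply: ler_wpM2l (AK t tT).
rewrite mulrA ler_pdivrMr ?ltr_pwDl ?mulr_ge0// mulrC ler_wpM2l ?ltW//.
by rewrite ltrDr.
Qed.

Variables (m n : nat) (A : R -> 'M[R]_m) (X0 : 'M[R]_(m, n)).
Hypothesis cA : continuous0y A.

Fixpoint peano_baker (k : nat) : R -> 'M[R]_(m, n) :=
  if k is k'.+1 then mxprim (fun s => A s *m peano_baker k' s) else fun=> X0.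

Lemma continuous0y_peano_baker k : continuous0y (peano_baker k).
Proof.
elim: k => [|k ih]; first exact: continuous0y_cst.
by have [] := is_derive0y_mxprim (continuous0y_mulmx cA ih).
Qed.

Lemma is_derive0y_peano_baker k :
  is_derive0y (peano_baker k.+1) (fun t => A t *m peano_baker k t).
Proof.
apply: is_derive0y_mxprim; apply: continuous0y_mulmx => //.
exact: continuous0y_peano_baker.
Qed.

Lemma peano_baker_le (K T : R) :
  0 <= K -> (forall t, 0 <= t <= T -> `|A t| <= K) ->
  forall k t, 0 <= t <= T ->
  `|peano_baker k t| <= `|X0| * expR (2 * (m%:R * K) * t) * 2^-1 ^+ k.
Proof.
move=> K0 AK; have l0 : 0 <= 2 * (m%:R * K) by rewrite !mulr_ge0.
elim=> [|k ih] t /andP[t0 tT].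
  by rewrite expr0 mulr1 ler_peMr// -[leLHS]expR0 ler_expR mulr_ge0.
have := is_derive0y_mx_dist_le (is_derive0y_peano_baker k)
  (is_derive0y_expR (`|X0| * 2^-1 ^+ k.+1) (2 * (m%:R * K))) t0.
rewrite {1}[peano_baker _ 0]mxprim0 subr0 => /(_ _)/le_trans; apply.
  move=> s /andP[s0 st]; have sT : 0 <= s <= T by rewrite !ltW// (lt_le_trans st).
  apply: le_trans (mx_norm_mulmx _ _) _.
  apply: le_trans (ler_pM _ (normr_ge0 _) _ (ih s sT)) _; first exact: mulr_ge0.
    by apply: ler_wpM2l (AK s sT).
  by rewrite exprS le_eqVlt; apply/orP; left; apply/eqP; field.
by rewrite [`|X0| * expR _ * _]mulrAC gerBl mulr_ge0 ?expR_ge0.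
Qed.

Lemma ucvg0y_peano_baker :
  ucvg0y (fun k t => series (peano_baker ^~ t) k)
         (fun t => limn (series (peano_baker ^~ t))).
Proof.
move=> T e e0; have [K K0 AK] := continuous0y_bounded T cA.
pose M := geometric (`|X0| * expR (2 * (m%:R * K) * T)) 2^-1.
have cM : cvgn (series M).
  by apply: is_cvg_geometric_series; rewrite ger0_norm ?invf_lt1 ?ltr1n ?invr_ge0.
have := cM; rewrite /= => /cvgrPdist_le/(_ e e0); apply: filterS => k Mk t tT.
apply: le_trans (series_norm_le_cvg _ cM k) (le_trans (ler_norm _) Mk) => i.
apply: le_trans (peano_baker_le K0 AK i tT) _.
rewrite ler_wpM2r ?exprn_ge0 ?invr_ge0// ler_wpM2l// ler_expR ler_wpM2l ?mulr_ge0//.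
by have /andP[] := tT.
Qed.

Theorem linear_ode_exists :
  exists2 X : R -> 'M[R]_(m, n), X 0 = X0 & is_derive0y X (fun t => A t *m X t).
Proof.
set E := peano_baker; pose S k t := series (E ^~ t) k.
pose X t := limn (series (E ^~ t)).
have SX : ucvg0y S X by exact: ucvg0y_peano_baker.
have cS k : continuous0y (S k).
  rewrite /S; under [X in continuous0y X]eq_fun do rewrite seriesEnat.
  by apply: continuous0y_sum => i _; exact: continuous0y_peano_baker.
have S_S k t : S k.+1 t = X0 + \sum_(0 <= i < k) E i.+1 t.
  by rewrite /S seriesEnat/= big_nat_recl.
exists X.
  have S0 k : S k.+1 0 = X0.
    by rewrite S_S big1 ?addr0// => i _; rewrite [E _ _]mxprim0.
  rewrite /X; apply: cvg_lim; first exact: norm_hausdorff.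
  by rewrite -cvg_shiftS; apply: cvg_near_cst; apply: nearW.
apply: (@is_derive0y_ucvg _ _ (fun k => S k.+1) (fun k t => A t *m S k t)).
- move=> k.
  have := is_derive0yD (is_derive0y_cst X0) (is_derive0y_sum (index_iota 0 k)
    (P := xpredT) (fun i _ => is_derive0y_peano_baker i)).
  apply: eq_is_derive0y => t _; first by rewrite S_S.
  by rewrite add0r -mulmx_sumr /S seriesEnat.
- by move=> k; exact: continuous0y_mulmx.
- exact: ucvg0y_mulmx.
- by move=> t t0; rewrite (cvg_shiftS (S ^~ t)); exact: ucvg0y_cvg.
Qed.

End linear_ode.

(** * Brackets as families of bilinear forms *)

Section forms.
Context {R : comNzRingType}.

(* A bracket [nu] is represented by the matrices [f k] of the bilinear forms
   [<nu (_, _), e_k>]: then [pushf A f] represents [A nu (_, _)] and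
   [pullf h f] represents [nu (h _, h _)]. *)
Definition pushf (q p n : nat) (A : 'M[R]_(q, p)) (f : 'I_p -> 'M[R]_n) :
  'I_q -> 'M[R]_n := fun k => \sum_l A k l *: f l.

Definition pullf (p m n : nat) (h : 'M[R]_(m, n)) (f : 'I_p -> 'M[R]_m) :
  'I_p -> 'M[R]_n := fun k => h^T *m f k *m h.

(* The Gram matrix of the forms [f k] for [(A, B) |-> \tr (A G B^T G)], the inner
   product that [G] induces on bilinear forms. *)
Definition form_gram (p n : nat) (f : 'I_p -> 'M[R]_n) (G : 'M[R]_n) : 'M[R]_p :=
  \matrix_(k, l) \tr (f k *m G *m (f l)^T *m G).

Definition pi_forms (n : nat) (A : 'M[R]_n) (f : 'I_n -> 'M[R]_n) : 'I_n -> 'M[R]_n :=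
  fun k => pushf A f k - A^T *m f k - f k *m A.

Lemma pushf_entry (q p n : nat) (A : 'M[R]_(q, p)) (f : 'I_p -> 'M[R]_n) k i j :
  pushf A f k i j = \sum_l A k l * f l i j.
Proof. by rewrite summxE; apply: eq_bigr => l _; rewrite mxE. Qed.

Lemma pushf1 (p n : nat) (f : 'I_p -> 'M[R]_n) : pushf 1%:M f = f.
Proof.
apply/funext => k; rewrite /pushf (bigD1 k)//= big1 ?addr0 => [|l /negbTE lk].
  by rewrite mxE eqxx scale1r.
by rewrite mxE eq_sym lk scale0r.
Qed.

Lemma pushf_comp (r q p n : nat) (A : 'M[R]_(r, q)) (B : 'M[R]_(q, p))
    (f : 'I_p -> 'M[R]_n) : pushf A (pushf B f) = pushf (A *m B) f.
Proof.
apply/funext => k; rewrite /pushf; under eq_bigr do rewrite scaler_sumr.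
rewrite exchange_big/=; apply: eq_bigr => l _; rewrite mxE scaler_suml.
by apply: eq_bigr => i _; rewrite scalerA.
Qed.

Lemma pushfZ (q p n : nat) (A : 'M[R]_(q, p)) (a : R) (f : 'I_p -> 'M[R]_n) :
  pushf A (a *: f) = a *: pushf A f.
Proof.
apply/funext => k; rewrite [RHS]scaler_sumr; apply: eq_bigr => l _ /=.
by rewrite !scalerA mulrC.
Qed.

Lemma pushfB (q p n : nat) (A : 'M[R]_(q, p)) (f g : 'I_p -> 'M[R]_n) k :
  pushf A (fun l => f l - g l) k = pushf A f k - pushf A g k.
Proof. by rewrite /pushf -sumrB; apply: eq_bigr => l _; rewrite scalerBr. Qed.

Lemma mulmx_pushf (q p n : nat) (A : 'M[R]_(q, p)) (f : 'I_p -> 'M[R]_n)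
    (B C : 'M[R]_n) k :
  B *m pushf A f k *m C = pushf A (fun l => B *m f l *m C) k.
Proof.
rewrite /pushf mulmx_sumr mulmx_suml; apply: eq_bigr => l _.
by rewrite -scalemxAr -scalemxAl.
Qed.

Lemma pushf_pullf (q p m n : nat) (A : 'M[R]_(q, p)) (h : 'M[R]_(m, n))
    (f : 'I_p -> 'M[R]_m) : pushf A (pullf h f) = pullf h (pushf A f).
Proof.
apply/funext => k; rewrite /pullf /pushf mulmx_sumr mulmx_suml.
by apply: eq_bigr => l _; rewrite -scalemxAr -scalemxAl.
Qed.

Lemma pullf1 (p n : nat) (f : 'I_p -> 'M[R]_n) : pullf 1%:M f = f.
Proof. by apply/funext => k; rewrite /pullf trmx1 mul1mx mulmx1. Qed.

Lemma pullf_comp (p l m n : nat) (g : 'M[R]_(l, m)) (h : 'M[R]_(m, n))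
    (f : 'I_p -> 'M[R]_l) : pullf h (pullf g f) = pullf (g *m h) f.
Proof. by apply/funext => k; rewrite /pullf trmx_mul !mulmxA. Qed.

Lemma pullfZ (p m n : nat) (h : 'M[R]_(m, n)) (a : R) (f : 'I_p -> 'M[R]_m) :
  pullf h (a *: f) = a *: pullf h f.
Proof. by apply/funext => k; rewrite /pullf -scalemxAr -scalemxAl. Qed.

Definition skewf (p n : nat) (f : 'I_p -> 'M[R]_n) := forall k, (f k)^T = - f k.

Lemma skewf_pushf (q p n : nat) (A : 'M[R]_(q, p)) (f : 'I_p -> 'M[R]_n) :
  skewf f -> skewf (pushf A f).
Proof.
move=> sk k; rewrite /pushf linear_sum/= -sumrN; apply: eq_bigr => l _.
by rewrite linearZ/= sk scalerN.
Qed.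

Lemma skewf_pullf (p m n : nat) (h : 'M[R]_(m, n)) (f : 'I_p -> 'M[R]_m) :
  skewf f -> skewf (pullf h f).
Proof. by move=> sk k; rewrite !trmx_mul trmxK sk mulNmx mulmxN mulmxA. Qed.

Lemma skewfZ (p n : nat) (a : R) (f : 'I_p -> 'M[R]_n) : skewf f -> skewf (a *: f).
Proof. by move=> sk k; rewrite [LHS]linearZ/= sk scalerN. Qed.

Lemma form_gram_pushf (q p n : nat) (A : 'M[R]_(q, p)) (f : 'I_p -> 'M[R]_n) G :
  form_gram (pushf A f) G = A *m form_gram f G *m A^T.
Proof.
apply/matrixP => k l; rewrite mxE mxE.
have -> : (pushf A f l)^T = \sum_b A l b *: (f b)^T.
  by rewrite linear_sum/=; apply: eq_bigr => b _; rewrite linearZ.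
rewrite mulmx_sumr mulmx_suml raddf_sum/=; apply: eq_bigr => b _.
rewrite -scalemxAr -scalemxAl linearZ/= [in RHS]mxE [A^T b l]mxE [RHS]mulrC.
congr (_ * _); rewrite !mulmx_suml raddf_sum/=; apply: eq_bigr => a _.
by rewrite -!scalemxAl linearZ/= mxE.
Qed.

Lemma form_gram_pullf (p m n : nat) (h : 'M[R]_(m, n)) (f : 'I_p -> 'M[R]_m) G :
  form_gram (pullf h f) G = form_gram f (h *m G *m h^T).
Proof.
apply/matrixP => k l; rewrite !mxE !trmx_mul trmxK.
by rewrite -!mulmxA mxtrace_mulC -!mulmxA.
Qed.

Lemma form_gramZ (p n : nat) (a : R) (f : 'I_p -> 'M[R]_n) G :
  form_gram (a *: f) G = a ^+ 2 *: form_gram f G.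
Proof.
apply/matrixP => k l; rewrite !mxE [(_ *: f) k]/= [(_ *: f) l]/= linearZ/=.
by rewrite -!(scalemxAl, scalemxAr) !linearZ/= mulrA.
Qed.

Lemma form_gramE (p n : nat) (f : 'I_p -> 'M[R]_n) G k l :
  form_gram f G k l =
  \sum_i \sum_j \sum_u \sum_v f k i j * f l v u * (G j u * G v i).
Proof.
rewrite mxE; apply: eq_bigr => i _.
transitivity (\sum_u \sum_v \sum_j f k i j * f l v u * (G j u * G v i)).
  rewrite exchange_big/= mxE; apply: eq_bigr => v _; rewrite mxE mulr_suml.
  apply: eq_bigr => u _; rewrite !mxE !mulr_suml; apply: eq_bigr => j _; ring.
by rewrite [RHS]exchange_big; apply: eq_bigr => u _; rewrite exchange_big.
Qed.

Lemma pi_forms_subr_scalar (n : nat) (A : 'M[R]_n) (a : R) (f : 'I_n -> 'M[R]_n) k :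
  pi_forms (A - a%:M) f k = pi_forms A f k + a *: f k.
Proof.
rewrite /pi_forms; have -> : pushf (A - a%:M) f k = pushf A f k - a *: f k.
  rewrite -[in a *: _](pushf1 f) scaler_sumr -sumrB; apply: eq_bigr => l _.
  by rewrite !mxE scalerBl scalerA -mulr_natr.
rewrite linearB/= tr_scalar_mx mulmxBl mulmxBr mul_scalar_mx mul_mx_scalar.
by apply/matrixP => i j; rewrite !mxE; ring.
Qed.

Lemma pi_formsZ (n : nat) (A : 'M[R]_n) (a : R) (f : 'I_n -> 'M[R]_n) :
  pi_forms A (a *: f) = a *: pi_forms A f.
Proof.
apply/funext => k; rewrite /pi_forms pushfZ /= -scalemxAr -scalemxAl.
by rewrite !fctE !scalerBr.
Qed.

Lemma pi_forms_intertwine (n : nat) (V A B : 'M[R]_n) (f c : 'I_n -> 'M[R]_n) :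
  pushf V f = pullf V c -> V *m A = B *m V ->
  pushf V (pi_forms A f) = pullf V (pi_forms B c).
Proof.
move=> Vf VA; apply/funext => k; rewrite /pi_forms !pushfB pushf_comp VA -pushf_comp.
have AV : A^T *m V^T = V^T *m B^T by rewrite -!trmx_mul VA.
have -> : pushf V (fun l => A^T *m f l) k = A^T *m pushf V f k.
  by rewrite -[RHS]mulmx1 mulmx_pushf; apply: eq_bigr => l _; rewrite mulmx1.
have -> : pushf V (fun l => f l *m A) k = pushf V f k *m A.
  by rewrite -[pushf V f k]mul1mx mulmx_pushf; apply: eq_bigr => l _; rewrite mul1mx.
rewrite Vf pushf_pullf /pullf mulmxBr mulmxBr !mulmxBl !mulmxA AV.
by rewrite -[_ *m V *m A]mulmxA VA !mulmxA.
Qed.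

End forms.

Lemma map_form_gram (R S : comNzRingType) (phi : {rmorphism R -> S}) (p n : nat)
    (f : 'I_p -> 'M[R]_n) (G : 'M[R]_n) :
  map_mx phi (form_gram f G) = form_gram (fun k => map_mx phi (f k)) (map_mx phi G).
Proof.
by apply/matrixP => k l; rewrite !mxE -trace_map_mx !map_mxM map_trmx.
Qed.

Section forms_limits.
Context {R : realType}.

Lemma cvg_pushf {T : Type} (F : set_system T) {FF : Filter F} (q p n : nat)
    (A : T -> 'M[R]_(q, p)) (f : T -> 'I_p -> 'M[R]_n) (Alim : 'M[R]_(q, p))
    (flim : 'I_p -> 'M[R]_n) :
  A @ F --> Alim -> (forall k, f t k @[t --> F] --> flim k) ->
  forall k, pushf (A t) (f t) k @[t --> F] --> pushf Alim flim k.
Proof.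
move=> /cvg_mxP hA hf k; apply: cvg_sum => l _; apply/cvg_mxP => i j; rewrite mxE.
under eq_cvg do rewrite mxE.
by apply: cvgM; [exact: hA|have /cvg_mxP := hf l; exact].
Qed.

Lemma cvg_pullf {T : Type} (F : set_system T) {FF : Filter F} (p m n : nat)
    (h : T -> 'M[R]_(m, n)) (f : T -> 'I_p -> 'M[R]_m) (hlim : 'M[R]_(m, n))
    (flim : 'I_p -> 'M[R]_m) :
  h @ F --> hlim -> (forall k, f t k @[t --> F] --> flim k) ->
  forall k, pullf (h t) (f t) k @[t --> F] --> pullf hlim flim k.
Proof.
by move=> hh hf k; apply: cvg_mulmx => //; apply: cvg_mulmx => //; exact: cvg_trmx.
Qed.

Lemma cvg_form_gram {T : Type} (F : set_system T) {FF : Filter F}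
    (p n : nat) (h : T -> 'I_p -> 'M[R]_n) (G : T -> 'M[R]_n)
    (hlim : 'I_p -> 'M[R]_n) (Glim : 'M[R]_n) :
  (forall k, h x k @[x --> F] --> hlim k) -> G @ F --> Glim ->
  form_gram (h x) (G x) @[x --> F] --> form_gram hlim Glim.
Proof.
move=> hl Gl; apply/cvg_mxP => k l; rewrite mxE; under eq_cvg do rewrite mxE.
apply: cvg_mxtrace; apply: cvg_mulmx => //; apply: cvg_mulmx; last exact: cvg_trmx.
exact: cvg_mulmx.
Qed.

End forms_limits.

Section brackets.
Context {R : realType} {N : nat}.
Implicit Types (c d : bracket R N) (A : 'M[R]_N).

Definition forms c : 'I_N -> 'M[R]_N := fun k => \matrix_(i, j) c i j k.

Lemma forms_inj : injective forms.
Proof.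
move=> c d cd; apply/funext => i; apply/funext => j; apply/funext => k.
by have /matrixP/(_ i j) := congr1 (fun f => f k) cd; rewrite !mxE.
Qed.

Lemma forms_bscale (r : R) c : forms (bscale r c) = r *: forms c.
Proof. by apply/funext => k; apply/matrixP => i j; rewrite !mxE. Qed.

Lemma forms_bzero : forms (@bzero R N) = 0.
Proof. by apply/funext => k; apply/matrixP => i j; rewrite !mxE. Qed.

Lemma skewf_forms c : skewf (forms c) <-> Defs.skew c.
Proof.
split=> [sk i j k|sk k]; last by apply/matrixP => i j; rewrite !mxE sk.
by have /matrixP/(_ j i) := sk k; rewrite !mxE.
Qed.

Lemma skew_diag c i k : Defs.skew c -> c i i k = 0.
Proof. by move=> sk; have := sk i i k; lra. Qed.

Lemma forms_pi_act A c : forms (pi_act A c) = pi_forms A (forms c).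
Proof.
apply/funext => k; apply/matrixP => i j; rewrite !mxE pushf_entry.
congr (_ - _ - _); apply: eq_bigr => l _; rewrite !mxE//.
by rewrite mulrC.
Qed.

Lemma forms_flow_rhs c k :
  forms (flow_rhs c) k = - pi_forms (Pmx c) (forms c) k - alpha c *: forms c k.
Proof.
rewrite -opprD -pi_forms_subr_scalar -forms_pi_act.
by apply/matrixP => i j; rewrite !mxE.
Qed.

Lemma tr_Pmx c : (Pmx c)^T = Pmx c.
Proof.
apply/matrixP => a b; rewrite !mxE; apply: eq_bigr => i _; apply: eq_bigr => j _.
exact: mulrC.
Qed.

Lemma mxtrace_Pmx c : \tr (Pmx c) = bdot c c.
Proof.
rewrite /mxtrace; under eq_bigr do rewrite mxE.
rewrite exchange_big/=; apply: eq_bigr => i _; rewrite exchange_big/=.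
exact: eq_bigr.
Qed.

Lemma sum_ltn_half (f : 'I_N -> 'I_N -> R) :
  (forall i j, f i j = f j i) -> (forall i, f i i = 0) ->
  \sum_(i < N) \sum_(j < N | (i < j)%N) f i j = 2^-1 * \sum_i \sum_j f i j.
Proof.
move=> fC f0; set S := LHS.
suff -> : \sum_i \sum_j f i j = S + S by field.
rewrite {2}/S [X in S + X](exchange_big_dep xpredT)//= /S -big_split/=.
apply: eq_bigr => i _.
rewrite (bigID (fun j : 'I_N => (i < j)%N))/=; congr (_ + _).
rewrite (bigD1 i) ?ltnn//= f0 add0r; apply: eq_big => [j|j _]; last exact: fC.
by rewrite -leqNgt ltn_neqAle andbC.
Qed.

Lemma Pmx_form_gram c :
  Defs.skew c -> Pmx c = 2^-1 *: form_gram (forms c) 1%:M.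
Proof.
move=> sk; apply/matrixP => a b; rewrite !mxE !mulmx1 sum_ltn_half.
- congr (_ * _); apply: eq_bigr => i _; rewrite mxE; apply: eq_bigr => j _.
  by rewrite !mxE.
- by move=> i j; rewrite [c i j a]sk [c i j b]sk mulrNN.
- by move=> i; rewrite skew_diag// mul0r.
Qed.

End brackets.

Section bdot.
Context {R : realType} {N : nat}.
Implicit Types c d e : bracket R N.

Lemma bdotDl (x y : R) c d e :
  bdot (fun i j k => x * c i j k + y * d i j k) e = x * bdot c e + y * bdot d e.
Proof.
rewrite /bdot !mulr_sumr -big_split; apply: eq_bigr => i _.
rewrite !mulr_sumr -big_split; apply: eq_bigr => j _.
rewrite !mulr_sumr -big_split; apply: eq_bigr => k _ /=.
by rewrite mulrDl !mulrA.
Qed.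

Lemma bdot_bscale (r : R) c : bdot (bscale r c) (bscale r c) = r ^+ 2 * bdot c c.
Proof.
rewrite /bdot; do 3![rewrite mulr_sumr; apply: eq_bigr => ? _].
by rewrite /bscale; ring.
Qed.

Lemma bdot_bzero : bdot (@bzero R N) (@bzero R N) = 0.
Proof. by rewrite /bdot; do 3![apply: big1 => ? _]; rewrite mulr0. Qed.

Lemma flow_rhsE c :
  flow_rhs c = (fun i j k => -1 * pi_act (Pmx c) c i j k + - alpha c * c i j k).
Proof.
apply: forms_inj; apply/funext => k; rewrite forms_flow_rhs -forms_pi_act.
by apply/matrixP => i j; rewrite !mxE; ring.
Qed.

Lemma bdot_flow_rhs c : bdot (flow_rhs c) c = alpha c * (1 - bdot c c).
Proof. by rewrite flow_rhsE bdotDl /alpha; ring. Qed.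

Lemma sqr_entry_le_bdot c (i j k : 'I_N) : Defs.skew c -> c i j k ^+ 2 <= bdot c c.
Proof.
move=> sk; have entry_le (x y : 'I_N) : (x < y)%N -> c x y k ^+ 2 <= bdot c c.
  move=> xy; rewrite /bdot (bigD1 x)//= (bigD1 y)//= (bigD1 k)//= expr2 -!addrA lerDl.
  by rewrite !addr_ge0//; do 3?[apply: sumr_ge0 => ? _]; rewrite -expr2 sqr_ge0.
have [/entry_le//|ji|/val_inj <-] := ltngtP i j.
  by rewrite sk sqrrN; exact: entry_le.
rewrite skew_diag// expr0n; do 3![apply: sumr_ge0 => ? _].
by rewrite -expr2 sqr_ge0.
Qed.

Lemma bdot_gt0 c : Defs.skew c -> c <> @bzero R N -> 0 < bdot c c.
Proof.
move=> sk c0; rewrite lt_neqAle eq_sym; apply/andP; split; last first.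
  by do 3![apply: sumr_ge0 => ? _]; rewrite -expr2 sqr_ge0.
apply/negP => /eqP cc0; apply: c0; do 3![apply/funext => ?].
by apply/eqP; rewrite -sqrf_eq0 eq_le sqr_ge0 -[X in _ <= X]cc0 sqr_entry_le_bdot.
Qed.

Lemma bdot_normalize c : Defs.skew c -> c <> @bzero R N ->
  bdot (bscale (bnorm c)^-1 c) (bscale (bnorm c)^-1 c) = 1.
Proof.
move=> sk /(bdot_gt0 sk) c0.
by rewrite bdot_bscale exprVn sqr_sqrtr ?ltW// mulVf ?gt_eqF.
Qed.

End bdot.

(** * Lower central series and adapted bases *)

Section lower_central_series.
Context {R : realType} {N : nat}.
Variable c : bracket R N.

(* Acts on row vectors from the right: [y *m ad_mx x] is the bracket of [x] and [y]. *)
Definition ad_mx (x : 'rV[R]_N) : 'M[R]_N := \matrix_(j, k) \sum_i x 0 i * c i j k.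

Lemma ad_mx_is_linear : linear ad_mx.
Proof.
move=> a x y; apply/matrixP => j k; rewrite !mxE mulr_sumr -big_split.
by apply: eq_bigr => i _; rewrite !mxE mulrDl mulrA.
Qed.

HB.instance Definition _ :=
  GRing.isLinear.Build R 'rV[R]_N 'M[R]_N _ ad_mx ad_mx_is_linear.

Lemma ad_mxE (x y : 'rV[R]_N) k : (y *m ad_mx x) 0 k = brapp c (x 0) (y 0) k.
Proof.
rewrite mxE /brapp exchange_big/=; apply: eq_bigr => j _; rewrite mxE mulr_sumr.
by apply: eq_bigr => i _; rewrite mulrCA mulrA.
Qed.

Lemma ad_mx_skew (x y : 'rV[R]_N) :
  Defs.skew c -> y *m ad_mx x = - (x *m ad_mx y).
Proof.
move=> sk; apply/rowP => k; rewrite [RHS]mxE !ad_mxE /brapp exchange_big/= -sumrN.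
apply: eq_bigr => j _; rewrite -sumrN; apply: eq_bigr => i _.
by rewrite sk mulrN [y 0 j * _]mulrC.
Qed.

Lemma ad_mx_bracket (x y : 'rV[R]_N) : Defs.skew c -> jacobi c ->
  ad_mx (y *m ad_mx x) = ad_mx y *m ad_mx x - ad_mx x *m ad_mx y.
Proof.
move=> sk ja; apply/row_matrixP => i; rewrite !rowE; set z := delta_mx 0 i.
have jacobi_rows : z *m ad_mx (y *m ad_mx x) + x *m ad_mx (z *m ad_mx y)
    + y *m ad_mx (x *m ad_mx z) = 0.
  apply/rowP => k; rewrite [LHS]mxE [X in X + _]mxE [RHS]mxE !ad_mxE.
  rewrite -[RHS](ja (x 0) (y 0) (z 0) k).
  by congr (_ + _ + _); congr brapp; apply/funext => j; rewrite ad_mxE.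
apply/eqP; rewrite -subr_eq0 -jacobi_rows mulmxBr !mulmxA opprB addrA addrAC.
rewrite [x *m ad_mx (z *m _)]ad_mx_skew// [x *m ad_mx z]ad_mx_skew// linearN mulmxN.
by rewrite [y *m ad_mx (z *m _)]ad_mx_skew// opprK.
Qed.

(* [lcsmx k] spans the [k.+1]-st term of the lower central series. *)
Fixpoint lcsmx (k : nat) : 'M[R]_N :=
  if k is k'.+1 then (\sum_i (lcsmx k' *m ad_mx (delta_mx 0 i)))%MS else 1%:M.

Arguments lcsmx : simpl never.

Lemma lcsmxS k : lcsmx k.+1 = (\sum_i (lcsmx k *m ad_mx (delta_mx 0 i)))%MS.
Proof. by []. Qed.

Lemma lcsmxS_sub k : (lcsmx k.+1 <= lcsmx k)%MS.
Proof.
elim: k => [|k ih]; first exact: submx1.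
by rewrite lcsmxS [in X in (_ <= X)%MS]lcsmxS; apply: sumsmxS => i _; exact: submxMr.
Qed.

Lemma lcsmx_ad_mx k (x y : 'rV[R]_N) :
  (y <= lcsmx k)%MS -> (y *m ad_mx x <= lcsmx k.+1)%MS.
Proof.
move=> yk; rewrite [x]row_sum_delta linear_sum/= mulmx_sumr.
apply: summx_sub => i _; rewrite linearZ/= -scalemxAr scalemx_sub//.
by rewrite (sumsmx_sup i)// submxMr.
Qed.

Lemma lcsmx_bracket a b (x y : 'rV[R]_N) : Defs.skew c -> jacobi c ->
  (x <= lcsmx a)%MS -> (y <= lcsmx b)%MS -> (y *m ad_mx x <= lcsmx (a + b).+1)%MS.
Proof.
move=> sk ja; elim: a b x y => [|a ih] b x y; first by move=> _; exact: lcsmx_ad_mx.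
rewrite lcsmxS => /sub_sumsmxP[u ->] yb; rewrite linear_sum/= mulmx_sumr.
apply: summx_sub => i _; rewrite mulmxA ad_mx_bracket// mulmxBr !mulmxA.
set x' := u i *m lcsmx a; have x'a : (x' <= lcsmx a)%MS by exact: submxMl.
apply: addmx_sub; first by rewrite addSn lcsmx_ad_mx// ih.
by rewrite eqmx_opp addSnnS ih// lcsmx_ad_mx.
Qed.

Lemma eq_lcs (x y : nat -> vec R N) m :
  (forall k, (k <= m)%N -> x k = y k) -> lcs c x m = lcs c y m.
Proof.
elim: m => [|m ih] xy /=; first exact: xy.
by rewrite ih ?xy// => k km; apply: xy; rewrite leqW.
Qed.

Lemma lcsmx_annihilator k p (A : 'M[R]_(N, p)) :
  (forall x, (\row_j lcs c x k j) *m A = 0) -> lcsmx k *m A = 0.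
Proof.
elim: k p A => [|k ih] p A lcsA.
  rewrite mul1mx; apply/row_matrixP => i; rewrite row0 rowE.
  rewrite -[RHS](lcsA (fun=> (delta_mx 0 i : 'rV[R]_N) 0)); congr (_ *m _).
  by apply/rowP => j; rewrite [RHS]mxE.
rewrite lcsmxS; apply/sub_kermxP/sumsmx_subP => i _; apply/sub_kermxP; rewrite -mulmxA.
apply: ih => x; rewrite mulmxA.
pose e_i : 'rV[R]_N := delta_mx 0 i.
rewrite -[RHS](lcsA (fun l => if l == k.+1 then e_i 0 else x l)).
congr (_ *m _); apply/rowP => j; rewrite ad_mxE mxE/= eqxx; congr brapp.
apply/funext => l; rewrite mxE; congr (_ l); apply: eq_lcs => l' l'k.
by rewrite ltn_eqF.
Qed.

Lemma nilpotent_lcsmx : nilpotent c -> exists m, lcsmx m = 0.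
Proof.
move=> [m lcs0]; exists m; rewrite -[lcsmx m]mulmx1; apply: lcsmx_annihilator => x.
by rewrite mulmx1; apply/rowP => j; rewrite !mxE lcs0.
Qed.

End lower_central_series.

Section filtration_basis.
Context {R : realType} {N : nat}.

(* The rows of [B] with [d i >= l] form a basis of [L l], for each [l >= k]. *)
Definition filtration_basis (L : nat -> 'M[R]_N) (k r : nat) (B : 'M[R]_(r, N))
    (d : 'I_r -> nat) :=
  [/\ row_free B, forall i, (k <= d i)%N /\ (row i B <= L (d i))%MS &
    forall l (v : 'rV[R]_N), (k <= l)%N -> (v <= L l)%MS ->
      exists2 u : 'rV_r, v = u *m B & forall i, u 0 i != 0 -> (l <= d i)%N].

Lemma filtration_basis_sub (L : nat -> 'M[R]_N) k r (B : 'M[R]_(r, N)) d :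
  (forall l, (L l.+1 <= L l)%MS) -> filtration_basis L k B d -> (B :=: L k)%MS.
Proof.
move=> Ldec [_ dB LB]; have Lk l : (k <= l)%N -> (L l <= L k)%MS.
  elim: l => [|l ih]; first by rewrite leqn0 => /eqP ->.
  rewrite leq_eqVlt => /predU1P[->//|/ltnSE/ih]; exact: submx_trans.
apply/eqmxP/andP; split.
  by apply/row_subP => i; have [ki] := dB i; move/submx_trans; apply; exact: Lk.
by apply/rV_subP => v /(LB k v (leqnn k))[u -> _]; exact: submxMl.
Qed.

Lemma filtration_basis0 (L : nat -> 'M[R]_N) m :
  (forall l, (L l.+1 <= L l)%MS) -> L m = 0 ->
  filtration_basis L m (0 : 'M[R]_(0, N)) (fun=> 0%N).
Proof.
move=> Ldec Lm; have Ll l : (m <= l)%N -> L l = 0.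
  elim: l => [|l ih]; first by rewrite leqn0 => /eqP <-.
  rewrite leq_eqVlt => /predU1P[<-//|/ltnSE/ih Ll0].
  by apply/eqP; rewrite -submx0 -Ll0.
split=> [|[]//|l v /Ll ->]; first by rewrite /row_free mxrank0.
by rewrite submx0 => /eqP ->; exists 0; [rewrite mul0mx|case].
Qed.

Lemma filtration_basis_extend (L : nat -> 'M[R]_N) k r (B : 'M[R]_(r, N)) d :
  (forall l, (L l.+1 <= L l)%MS) -> filtration_basis L k.+1 B d ->
  exists r' (B' : 'M[R]_(r', N)) d', filtration_basis L k B' d'.
Proof.
move=> Ldec fB; have BL := filtration_basis_sub Ldec fB.
have [freeB dB LB] := fB; set D := (L k :\: L k.+1)%MS.
exists (r + \rank D)%N, (col_mx B (row_base D)),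
  (fun i => match fintype.split i with inl j => d j | inr _ => k end).
split.
- rewrite /row_free -addsmxE mxrank_disjoint_sum ?eq_row_base ?(eqP freeB)//.
  apply/eqP; rewrite -submx0 -(capmx_diff (L k) (L k.+1)) capmxC.
  by rewrite capmxS ?BL// eq_row_base.
- move=> i; rewrite -{2}(splitK i); case: (fintype.split i) => j /=.
    by rewrite rowKu; have [kj ->] := dB j; rewrite ltnW.
  by rewrite rowKd (submx_trans (row_sub _ _))// eq_row_base diffmxSl.
- move=> l v; rewrite leq_eqVlt => /predU1P[<-|kl] vl; last first.
    have [u -> ud] := LB l v kl vl.
    exists (row_mx u 0); first by rewrite mul_row_col mul0mx addr0.
    move=> i; rewrite -{1}(splitK i); case: (fintype.split i) => j /=.
      by rewrite row_mxEl; exact: ud.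
    by rewrite row_mxEr mxE eqxx.
  have /submxP[u ->] : (v <= col_mx B (row_base D))%MS.
    rewrite -addsmxE (submx_trans vl)// -(addsmx_diff_cap_eq (L k) (L k.+1)) addsmxC.
    by rewrite addsmxS ?eq_row_base// BL capmxSr.
  exists u => // i _; case: (fintype.split i) => // j.
  by have [/ltnW] := dB j.
Qed.

Lemma filtration_basis_exists (L : nat -> 'M[R]_N) m :
  (forall l, (L l.+1 <= L l)%MS) -> L 0%N = 1%:M -> L m = 0 ->
  exists (B : 'M[R]_N) (d : 'I_N -> nat), B \in unitmx /\ filtration_basis L 0 B d.
Proof.
move=> Ldec L0 Lm.
have basis k : (k <= m)%N ->
    exists r (B : 'M[R]_(r, N)) d, filtration_basis L (m - k) B d.
  elim: k => [_|k ih km].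
    by exists 0%N, 0, (fun=> 0%N); rewrite subn0; exact: filtration_basis0.
  have [r [B [d]]] := ih (ltnW km).
  by rewrite -(subnSK km); exact: filtration_basis_extend.
have [r [B [d]]] := basis m (leqnn m); rewrite subnn => fB.
have [freeB _ _] := fB; have B1 := filtration_basis_sub Ldec fB.
have rN : r = N by rewrite -(eqP freeB) B1 L0 mxrank1.
by subst r; exists B, d; rewrite -row_free_unit.
Qed.

End filtration_basis.

Section depth.
Context {S : comNzRingType} {N : nat}.
Variable d : 'I_N -> nat.
Implicit Type f : 'I_N -> 'M[S]_N.

Definition depth_superadditive f :=
  forall i j k, f k i j != 0 -> (d i + d j < d k)%N.

Definition graded_part f : 'I_N -> 'M[S]_N :=
  fun k => \matrix_(i, j) (if d k == (d i + d j).+1 then f k i j else 0).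

Definition generated_by_depth0 f :=
  forall xi : 'rV[S]_N, pushf xi f = 0 -> forall a, (0 < d a)%N -> xi 0 a = 0.

End depth.

Section nilpotent_adapted_basis.
Context {R : realType} {N : nat}.
Variables (c : bracket R N) (B : 'M[R]_N) (d : 'I_N -> nat).
Hypotheses (skew_c : Defs.skew c) (jacobi_c : jacobi c) (B_unit : B \in unitmx).
Hypothesis lcs_B : filtration_basis (lcsmx c) 0 B d.

Definition adapted_forms : 'I_N -> 'M[R]_N :=
  pushf (invmx B)^T (pullf B^T (forms c)).

Lemma adapted_forms_entry k i j :
  adapted_forms k i j = (row j B *m ad_mx c (row i B) *m invmx B) 0 k.
Proof.
rewrite pushf_entry mxE; apply: eq_bigr => l _; rewrite [_^T k l]mxE mulrC; congr (_ * _).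
rewrite /pullf trmxK !mxE; apply: eq_bigr => b _; rewrite !mxE mulrC; congr (_ * _).
by apply: eq_bigr => a _; rewrite !mxE.
Qed.

Lemma adapted_coord (v : 'rV[R]_N) l i :
  (v <= lcsmx c l)%MS -> (v *m invmx B) 0 i != 0 -> (l <= d i)%N.
Proof.
have [_ _ LB] := lcs_B; move=> /(LB l v (leq0n l))[u ->].
by rewrite mulmxK//; exact.
Qed.

Lemma adapted_forms_superadditive : depth_superadditive d adapted_forms.
Proof.
move=> i j k; rewrite adapted_forms_entry; apply: adapted_coord.
by have [_ dB _] := lcs_B; apply: lcsmx_bracket => //; have [] := dB i; have [] := dB j.
Qed.

Lemma adapted_annihilator (phi : 'cV[R]_N) l :
  (forall i j, (l <= d j)%N -> row j B *m ad_mx c (row i B) *m phi = 0) ->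
  lcsmx c l.+1 *m phi = 0.
Proof.
move=> Bphi; have [_ _ LB] := lcs_B.
rewrite lcsmxS; apply/sub_kermxP/sumsmx_subP => i _; apply/sub_kermxP/row_matrixP => j.
rewrite row0 !row_mul; have [u -> u_d] := LB l _ (leq0n l) (row_sub j (lcsmx c l)).
rewrite -[delta_mx 0 i](mulmxKV B_unit) [u *m B]mulmx_sum_row !mulmx_suml.
apply: big1 => b _; rewrite -!scalemxAl.
have [->|/u_d lb] := eqVneq (u 0 b) 0; first by rewrite scale0r.
rewrite [_ *m B]mulmx_sum_row linear_sum mulmx_sumr mulmx_suml big1 ?scaler0// => a _.
by rewrite linearZ -scalemxAr -scalemxAl Bphi ?scaler0.
Qed.

(* Pairing [xi] with the brackets of basis vectors shows that its part of depth
   [l.+1] annihilates [lcsmx l.+1], to which the basis vectors of that depth belong. *)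
Lemma adapted_forms_generated : generated_by_depth0 d (graded_part d adapted_forms).
Proof.
move=> xi xi0 a; case da : (d a) => [//|l] _.
pose xil : 'rV[R]_N := \row_b (if d b == l.+1 then xi 0 b else 0).
pose phi := invmx B *m xil^T.
have phi0 : lcsmx c l.+1 *m phi = 0.
  apply: adapted_annihilator => i j lj; rewrite mulmxA.
  apply/rowP => z; rewrite [LHS]mxE [RHS]mxE.
  have -> : \sum_b (row j B *m ad_mx c (row i B) *m invmx B) 0 b * xil^T b z =
      \sum_b (if d b == l.+1 then xi 0 b else 0) * adapted_forms b i j.
    by apply: eq_bigr => b _; rewrite adapted_forms_entry mulrC [xil^T b z]mxE [xil z b]mxE.
  have [lij|nlij] := eqVneq l (d i + d j)%N.
    have := congr1 (fun f : 'I_1 -> 'M[R]_N => f 0 i j) xi0.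
    rewrite pushf_entry [RHS]mxE => xi0ij; rewrite -[RHS]xi0ij.
    apply: eq_bigr => b _; rewrite mxE lij.
    by case: ifP => _; rewrite ?mul0r ?mulr0.
  apply: big1 => b _; case: eqP => [db|_]; last by rewrite mul0r.
  have [->|/adapted_forms_superadditive] := eqVneq (adapted_forms b i j) 0.
    by rewrite mulr0.
  rewrite db ltnS => ijl; case/eqP: nlij; apply/eqP.
  by rewrite eqn_leq ijl (leq_trans lj) ?leq_addl.
have [_ dB _] := lcs_B; have [_] := dB a; rewrite da => /submxP[u rowB].
have := congr1 (fun v : 'rV_1 => v 0 0) (etrans (congr1 (mulmx^~ phi) rowB) _).
rewrite -mulmxA phi0 mulmx0 mulmxA -row_mul mulmxV// row1 -rowE.
by move=> /(_ _ erefl); rewrite !mxE da eqxx.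
Qed.

End nilpotent_adapted_basis.

Lemma adapted_basis_exists (R : realType) (N : nat) (c : bracket R N) :
  Defs.skew c -> jacobi c -> nilpotent c ->
  exists (B : 'M[R]_N) (d : 'I_N -> nat),
    [/\ B \in unitmx, depth_superadditive d (adapted_forms c B) &
        generated_by_depth0 d (graded_part d (adapted_forms c B))].
Proof.
move=> sk ja /nilpotent_lcsmx[m lcs0].
have [B [d [uB fB]]] := filtration_basis_exists (lcsmxS_sub c) (erefl _) lcs0.
exists B, d; split=> //; first exact: adapted_forms_superadditive.
exact: adapted_forms_generated.
Qed.

(** * Polynomial Gram matrices *)

Section primitive_polynomial.
Context {R : numFieldType}.

Definition primp (p : {poly R}) : {poly R} :=
  \poly_(i < (size p).+1) (if i is j.+1 then p`_j / j.+1%:R else 0).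

Lemma deriv_primp (p : {poly R}) : deriv (primp p) = p.
Proof.
apply/polyP => i; rewrite coef_deriv coef_poly ltnS.
case: ltnP => [ip|pi]; first by rewrite -[LHS]mulr_natr divfK// pnatr_eq0.
by rewrite mul0rn nth_default.
Qed.

Lemma horner_primp0 (p : {poly R}) : (primp p).[0] = 0.
Proof. by rewrite horner_coef0 coef_poly. Qed.

Lemma primp0 : primp 0 = 0.
Proof.
apply/polyP => i; rewrite coef_poly coef0; case: i => // i.
by rewrite coef0 mul0r if_same.
Qed.

Lemma size_primp (p : {poly R}) : (size (primp p) <= (size p).+1)%N.
Proof. exact: size_poly. Qed.

End primitive_polynomial.

Section form_gram_depth.
Context {S : comNzRingType} {N : nat}.
Variables (d : 'I_N -> nat) (f : 'I_N -> 'M[S]_N).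
Hypothesis superadd : depth_superadditive d f.

Lemma depth_superadditive_minn k l i j u v : f k i j * f l v u != 0 ->
  (minn (d j) (d u) + minn (d v) (d i) < minn (d k) (d l))%N.
Proof.
move=> nz; have fk : f k i j != 0 by apply: contraNneq nz => ->; rewrite mul0r.
have fl : f l v u != 0 by apply: contraNneq nz => ->; rewrite mulr0.
rewrite leq_min; apply/andP; split.
  by apply: leq_ltn_trans (superadd fk); rewrite addnC leq_add ?geq_minl ?geq_minr.
by apply: leq_ltn_trans (superadd fl); rewrite addnC leq_add ?geq_minl ?geq_minr.
Qed.

(* The system [G' = form_gram f G] is triangular. *)
Lemma eq_form_gram_depth k l (G H : 'M[S]_N) :
  (forall i j, (minn (d i) (d j) < minn (d k) (d l))%N -> G i j = H i j) ->
  form_gram f G k l = form_gram f H k l.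
Proof.
move=> GH; rewrite !form_gramE; apply: eq_bigr => i _; apply: eq_bigr => j _.
apply: eq_bigr => u _; apply: eq_bigr => v _.
have [->|/depth_superadditive_minn lt_kl] := eqVneq (f k i j * f l v u) 0.
  by rewrite !mul0r.
by congr (_ * (_ * _)); apply: GH; apply: leq_ltn_trans lt_kl; rewrite ?leq_addr ?leq_addl.
Qed.

End form_gram_depth.

Section gram_poly.
Context {R : realType} {N : nat}.
Variables (d : 'I_N -> nat) (f : 'I_N -> 'M[R]_N).
Hypothesis superadd : depth_superadditive d f.

Definition poly_forms : 'I_N -> 'M[{poly R}]_N := fun k => map_mx polyC (f k).

Definition evalmx (x : R) (GG : 'M[{poly R}]_N) : 'M[R]_N := map_mx (horner_eval x) GG.

Lemma poly_forms_superadditive : depth_superadditive d poly_forms.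
Proof. by move=> i j k; rewrite mxE polyC_eq0; exact: superadd. Qed.

Lemma evalmx_form_gram (x : R) (GG : 'M[{poly R}]_N) :
  evalmx x (form_gram poly_forms GG) = form_gram f (evalmx x GG).
Proof.
rewrite /evalmx map_form_gram; congr form_gram; apply/funext => k; apply/matrixP => i j.
by rewrite !mxE; exact: hornerC.
Qed.

(* Picard iteration for [G' = form_gram f G], which becomes stationary. *)
Fixpoint gram_poly (G0 : 'M[R]_N) (n : nat) : 'M[{poly R}]_N :=
  if n is n'.+1 then
    map_mx polyC G0 + map_mx primp (form_gram poly_forms (gram_poly G0 n'))
  else map_mx polyC G0.

Lemma gram_polyS (G0 : 'M[R]_N) n k l : gram_poly G0 n.+1 k l =
  (G0 k l)%:P + primp (form_gram poly_forms (gram_poly G0 n) k l).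
Proof. by rewrite [LHS]mxE [X in X + _]mxE [X in _ + X]mxE. Qed.

Lemma gram_poly_stationary (G0 : 'M[R]_N) n k l :
  (minn (d k) (d l) <= n)%N -> gram_poly G0 n.+1 k l = gram_poly G0 n k l.
Proof.
elim: n k l => [|n ih] k l kln; rewrite gram_polyS.
  rewrite (eq_form_gram_depth poly_forms_superadditive (H := 0)).
    by rewrite mxE mulmx0 mxtrace0 primp0 addr0 mxE.
  by move=> i j /leq_trans/(_ kln).
rewrite gram_polyS; congr (_ + primp _).
apply: (eq_form_gram_depth poly_forms_superadditive) => i j ijkl.
by apply: ih; rewrite -ltnS (leq_trans ijkl).
Qed.

Lemma size_gram_poly (G0 : 'M[R]_N) n k l :
  (size (gram_poly G0 n k l) <= (minn (d k) (d l)).+1)%N.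
Proof.
elim: n k l => [|n ih] k l.
  by rewrite mxE (leq_trans (size_polyC_leq1 _)).
rewrite gram_polyS (leq_trans (size_polyD _ _))// geq_max.
rewrite (leq_trans (size_polyC_leq1 _))//= (leq_trans (size_primp _))// ltnS form_gramE.
apply: leq_trans (size_sum _ _ _) _; apply/bigmax_leqP => i _.
apply: leq_trans (size_sum _ _ _) _; apply/bigmax_leqP => j _.
apply: leq_trans (size_sum _ _ _) _; apply/bigmax_leqP => u _.
apply: leq_trans (size_sum _ _ _) _; apply/bigmax_leqP => v _.
have [->|] := eqVneq (poly_forms k i j * poly_forms l v u) 0.
  by rewrite mul0r size_poly0.
move/(depth_superadditive_minn poly_forms_superadditive)/(leq_trans _); apply.
rewrite !mxE -polyCM mul_polyC (leq_trans (size_scale_leq _ _))//.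
rewrite (leq_trans (size_polyMleq _ _))// -subn1 leq_subLR add1n -addnS -addSn.
exact: leq_add.
Qed.

Lemma gram_poly_exists (G0 : 'M[R]_N) : exists GG : 'M[{poly R}]_N,
  [/\ evalmx 0 GG = G0, map_mx (deriv (R := R)) GG = form_gram poly_forms GG &
      forall k l, (size (GG k l) <= (minn (d k) (d l)).+1)%N].
Proof.
pose n := (\max_k d k)%N; pose GG := gram_poly G0 n.
have GGE k l : GG k l = (G0 k l)%:P + primp (form_gram poly_forms GG k l).
  rewrite -gram_polyS gram_poly_stationary//.
  by rewrite (leq_trans (geq_minl _ _))// leq_bigmax.
exists GG; split; last exact: size_gram_poly.
- apply/matrixP => k l; rewrite mxE GGE /horner_eval hornerD hornerC.
  by rewrite horner_primp0 addr0.
- by apply/matrixP => k l; rewrite mxE GGE derivD derivC add0r deriv_primp.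
Qed.

Lemma form_gram_flow_unique (GG : 'M[{poly R}]_N) (G : R -> 'M[R]_N)
    (s ds : R -> R) (t : R) :
  map_mx (deriv (R := R)) GG = form_gram poly_forms GG -> evalmx 0 GG = G 0 ->
  s 0 = 0 -> is_derive0y s ds ->
  is_derive0y G (fun t => ds t *: form_gram f (G t)) ->
  0 <= t -> G t = evalmx (s t) GG.
Proof.
move=> dGG GG0 s0 hs /is_derive0y_mxP hG; move: t.
suff eqG n k l t : (minn (d k) (d l) < n)%N -> 0 <= t -> G t k l = evalmx (s t) GG k l.
  by move=> t t0; apply/matrixP => k l; exact: (eqG (minn (d k) (d l)).+1).
elim: n k l t => // n ih k l t kln t0.
have hGG := is_derive0y_comp (is_derive_poly (GG k l)) hs.
apply/eqP; rewrite -subr_eq0 [X in _ - X]mxE; apply/eqP.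
have := is_derive0y_0_is_cst (is_derive0y_eq _ (is_derive0yB (hG k l) hGG)) t0.
rewrite /= s0 -GG0 [evalmx 0 GG k l]mxE subrr; apply=> u u0.
rewrite [X in X - _]mxE [ds u * _]mulrC -mulrBl.
have -> : (deriv (GG k l)).[s u] = form_gram f (evalmx (s u) GG) k l.
  by rewrite -evalmx_form_gram -dGG !mxE.
rewrite (eq_form_gram_depth superadd (H := evalmx (s u) GG)) ?subrr ?mul0r// => i j ijkl.
by apply: ih; [exact: leq_trans ijkl kln|exact: ltW].
Qed.

End gram_poly.

(** * The graded limit *)

Section depth_scale.
Context {R : realType} {N : nat}.
Variables (d : 'I_N -> nat) (f : 'I_N -> 'M[R]_N).
Hypothesis superadd : depth_superadditive d f.

Definition depth_scale (e : R) : 'M[R]_N := diag_mx (\row_k (e ^+ d k)).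

Definition rescaled_forms (e : R) : 'I_N -> 'M[R]_N :=
  fun k => \matrix_(i, j) (e ^+ (d k - (d i + d j).+1) * f k i j).

Lemma tr_depth_scale e : (depth_scale e)^T = depth_scale e.
Proof. exact: tr_diag_mx. Qed.

Lemma depth_scale_conj e (A : 'M[R]_N) k l :
  (depth_scale e *m A *m depth_scale e) k l = e ^+ d k * A k l * e ^+ d l.
Proof. by rewrite mul_mx_diag mul_diag_mx !mxE. Qed.

Lemma pushf_depth_scale e :
  pushf (depth_scale e) f = e *: pullf (depth_scale e) (rescaled_forms e).
Proof.
apply/funext => k; apply/matrixP => i j.
rewrite pushf_entry [RHS]mxE /pullf tr_depth_scale depth_scale_conj mxE.
rewrite (bigD1 k)//= big1 => [|l /negbTE lk]; last first.
  by rewrite !mxE eq_sym lk mulr0n mul0r.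
rewrite !mxE eqxx mulr1n addr0.
have [->|/superadd lt_k] := eqVneq (f k i j) 0; first by rewrite !(mulr0, mul0r).
by rewrite -[in LHS](subnK lt_k) -addSn exprD addSn exprS exprD; ring.
Qed.

Lemma cvg_rescaled_forms k : rescaled_forms e k @[e --> 0] --> graded_part d f k.
Proof.
apply/cvg_mxP => i j; rewrite mxE; under eq_cvg do rewrite mxE.
have -> : (if d k == (d i + d j).+1 then f k i j else 0) =
    0 ^+ (d k - (d i + d j).+1) * f k i j.
  have [->|/superadd lt_k] := eqVneq (f k i j) 0; first by rewrite mulr0 if_same.
  rewrite expr0n subn_eq0 eqn_leq [(_.+1 <= d k)%N]lt_k andbT.
  by case: (d k <= _)%N; rewrite ?mul1r ?mul0r.
by apply: cvgM; [exact: exprn_continuous|exact: cvg_cst].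
Qed.

Lemma cvg_scaled_horner (p : {poly R}) (a b : nat) : (size p <= (minn a b).+1)%N ->
  e ^+ a * p.[e^-1 ^+ 2] * e ^+ b @[e --> 0^'] --> if a == b then p`_a else 0.
Proof.
move=> sp; pose q : {poly R} := \sum_(i < (minn a b).+1) p`_i *: 'X^(a + b - i.*2).
have qE : \forall e \near 0^', q.[e] = e ^+ a * p.[e^-1 ^+ 2] * e ^+ b.
  near=> e; have e0 : e != 0 by near: e; exact: nbhs_dnbhs_neq.
  rewrite (horner_coef_wide _ sp) mulr_sumr mulr_suml horner_sum.
  apply: eq_bigr => i _; have := ltn_ord i; rewrite ltnS leq_min => /andP[ia ib].
  have iab : (i.*2 <= a + b)%N by rewrite -addnn leq_add.
  rewrite hornerZ hornerXn mulrCA -!mulrA; congr (_ * _); rewrite -exprM mul2n.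
  by rewrite mulrCA -exprD -[in RHS](subnK iab) exprD mulrCA -exprMn mulVf// expr1n mulr1.
have q0 : q.[0] = if a == b then p`_a else 0.
  rewrite horner_sum; under eq_bigr do rewrite hornerZ hornerXn expr0n subn_eq0.
  case: eqP => [<-|ab].
    rewrite minnn (bigD1 ord_max)//= addnn leqnn mulr1 big1 ?addr0// => i ia.
    rewrite leq_double leqNgt ltn_neqAle -ltnS ltn_ord andbT -[_ != a]/(i != ord_max).
    by rewrite ia mulr0.
  apply: big1 => i _; have := ltn_ord i; rewrite ltnS leq_min => /andP[ia ib].
  by rewrite leqNgt (_ : (_ < _)%N) ?mulr0//; lia.
rewrite -q0; apply: cvg_trans (near_eq_cvg qE) _.
by apply: cvg_within_filter; exact: continuous_horner.
Unshelve. all: by end_near. Qed.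

End depth_scale.

Section limit_gram.
Context {R : realType} {N : nat}.
Variables (d : 'I_N -> nat) (f : 'I_N -> 'M[R]_N) (GG : 'M[{poly R}]_N).
Hypothesis superadd : depth_superadditive d f.
Hypothesis size_GG : forall k l, (size (GG k l) <= (minn (d k) (d l)).+1)%N.

Definition limit_gram (P : 'M[{poly R}]_N) : 'M[R]_N :=
  \matrix_(k, l) if d k == d l then (P k l)`_(d k) else 0.

Lemma cvg_limit_gram (P : 'M[{poly R}]_N) :
  (forall k l, (size (P k l) <= (minn (d k) (d l)).+1)%N) ->
  depth_scale d e *m evalmx (e^-1 ^+ 2) P *m depth_scale d e @[e --> 0^'] -->
  limit_gram P.
Proof.
move=> sP; apply/cvg_mxP => k l; rewrite mxE.
under eq_cvg do rewrite depth_scale_conj mxE.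
exact: cvg_scaled_horner.
Qed.

Lemma depth0_limit_gram (x : 'rV[R]_N) : (forall a, (0 < d a)%N -> x 0 a = 0) ->
  x *m limit_gram GG *m x^T = x *m evalmx 0 GG *m x^T.
Proof.
move=> x0; apply/matrixP => i j; rewrite [LHS]mxE [RHS]mxE; apply: eq_bigr => l _.
rewrite [x^T l j]mxE (ord1 j); have [dl|/x0 ->] := posnP (d l); last by rewrite !mulr0.
congr (_ * _); rewrite [LHS]mxE [RHS]mxE; apply: eq_bigr => k _; rewrite (ord1 i).
have [dk|/x0 ->] := posnP (d k); last by rewrite !mul0r.
by congr (_ * _); rewrite !mxE dl dk eqxx /horner_eval horner_coef0.
Qed.

Lemma form_gram_rescaled (e : R) : e != 0 ->
  map_mx (deriv (R := R)) GG = form_gram (poly_forms f) GG ->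
  form_gram (rescaled_forms d f e)
    (depth_scale d e *m evalmx (e^-1 ^+ 2) GG *m depth_scale d e) =
  depth_scale d e *m evalmx (e^-1 ^+ 2) (\matrix_(k, l) ('X * deriv (GG k l)))
    *m depth_scale d e.
Proof.
move=> e0 dGG; rewrite -{2}[depth_scale d e]tr_depth_scale -form_gram_pullf.
have -> : pullf (depth_scale d e) (rescaled_forms d f e) =
    e^-1 *: pushf (depth_scale d e) f.
  by rewrite pushf_depth_scale// scalerA mulVf ?scale1r.
rewrite form_gramZ form_gram_pushf tr_depth_scale -evalmx_form_gram -dGG.
rewrite scalemxAl scalemxAr; congr (_ *m _ *m _); apply/matrixP => k l.
by rewrite !mxE /horner_eval hornerM hornerX.
Qed.

(* The graded limit of the equation [GG' = form_gram f GG]. *)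
Lemma form_gram_limit_gram :
  map_mx (deriv (R := R)) GG = form_gram (poly_forms f) GG ->
  form_gram (graded_part d f) (limit_gram GG) =
  diag_mx (\row_k (d k)%:R) *m limit_gram GG.
Proof.
move=> dGG; pose XdGG : 'M[{poly R}]_N := \matrix_(k, l) ('X * deriv (GG k l)).
have -> : diag_mx (\row_k (d k)%:R) *m limit_gram GG = limit_gram XdGG.
  apply/matrixP => k l; rewrite mul_diag_mx !mxE; case: eqP => _; last by rewrite mulr0.
  rewrite coefXM; case: (d k) => [|x]; first by rewrite mul0r.
  by rewrite coef_deriv mulr_natl.
have sXdGG k l : (size (XdGG k l) <= (minn (d k) (d l)).+1)%N.
  rewrite mxE; have [->|dn0] := eqVneq (deriv (GG k l)) 0.
    by rewrite mulr0 size_poly0.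
  rewrite mulrC size_mulX// (leq_trans _ (size_GG k l))// lt_size_deriv//.
  by apply: contraNneq dn0 => ->; rewrite deriv0.
have gram_cvg : form_gram (rescaled_forms d f e)
    (depth_scale d e *m evalmx (e^-1 ^+ 2) GG *m depth_scale d e) @[e --> 0^'] -->
    form_gram (graded_part d f) (limit_gram GG).
  apply: cvg_form_gram (cvg_limit_gram size_GG) => k.
  by apply: cvg_within_filter; exact: cvg_rescaled_forms.
apply: (cvg_unique (@norm_hausdorff _ _) gram_cvg).
apply: cvg_trans (cvg_limit_gram sXdGG); apply: near_eq_cvg; near=> e.
by rewrite form_gram_rescaled//; near: e; exact: nbhs_dnbhs_neq.
Unshelve. all: by end_near. Qed.

End limit_gram.

Section graded_forms.
Context {R : realType} {N : nat}.
Variables (d : 'I_N -> nat) (f : 'I_N -> 'M[R]_N).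
Hypothesis graded : forall i j k, f k i j != 0 -> d k = (d i + d j).+1.

(* For [x] in the kernel of [V] the form [Y = \sum_a x_a f_a] has zero norm, and it
   only involves depths smaller than those of [x]. *)
Lemma graded_kernel_trivial (V D : 'M[R]_N) :
  form_gram f (V *m V^T) = D *m (V *m V^T) -> generated_by_depth0 d f ->
  (forall x : 'rV[R]_N, (forall a, (0 < d a)%N -> x 0 a = 0) -> x *m V = 0 -> x = 0) ->
  forall x : 'rV[R]_N, x *m V = 0 -> x = 0.
Proof.
move=> gramD gen ker0 x; pose n := (\max_a d a)%N.
have : forall a, (n < d a)%N -> x 0 a = 0 by move=> a; rewrite ltnNge leq_bigmax.
elim: n x => [|n ih] x xn xV; first exact: ker0.
have kerM (A : 'M[R]_N) : (forall i a, (n < d a)%N -> A i a = 0) -> A *m V = 0 -> A = 0.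
  move=> An AV; apply/row_matrixP => i; rewrite row0; apply: ih => [a na|].
    by rewrite mxE An.
  by rewrite -row_mul AV row0.
set Y := pushf x f 0.
have YS i j : (n < d i)%N || (n < d j)%N -> Y i j = 0.
  move=> nij; rewrite [Y i j]pushf_entry big1// => a _.
  have [->|/graded da] := eqVneq (f a i j) 0; first by rewrite mulr0.
  rewrite xn ?mul0r// da ltnS; case/orP: nij => /leq_trans; apply; lia.
have VYV : V^T *m Y *m V = 0.
  apply: mxtrace_mulmx_tr_eq0.
  transitivity (form_gram (pullf V (pushf x f)) 1%:M 0 0); first by rewrite mxE !mulmx1.
  rewrite form_gram_pullf mulmx1 form_gram_pushf gramD -!mulmxA -trmx_mul xV.
  by rewrite trmx0 !mulmx0 mxE.
have VY : V^T *m Y = 0.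
  apply: kerM VYV => i a na; rewrite mxE big1// => j _.
  by rewrite YS ?mulr0// na orbT.
have Y0 : Y = 0.
  apply: trmx_inj; rewrite trmx0; apply: kerM => [i a na|].
    by rewrite mxE YS// na.
  by rewrite -[V]trmxK -trmx_mul VY trmx0.
by apply: ker0 xV; apply: gen; apply/funext => i; rewrite (ord1 i).
Qed.

Variables (V : 'M[R]_N) (nu : bracket R N) (kappa : R).
Hypotheses (V_unit : V \in unitmx) (skew_nu : Defs.skew nu).
Hypothesis gramD :
  form_gram f (V *m V^T) = diag_mx (\row_k (d k)%:R) *m (V *m V^T).
Hypothesis nu_graded : pushf V (forms nu) = kappa *: pullf V f.

Lemma graded_Pmx : V *m Pmx nu = (kappa ^+ 2 / 2 *: diag_mx (\row_k (d k)%:R)) *m V.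
Proof.
have VT_unit : V^T \in unitmx by rewrite unitmx_tr.
apply: (can_inj (mulmxK VT_unit)).
rewrite Pmx_form_gram// -scalemxAr -!scalemxAl -form_gram_pushf nu_graded.
rewrite form_gramZ form_gram_pullf mulmx1 gramD scalerA !mulmxA.
by congr (_ *: _); rewrite mulrC.
Qed.

(* [diag_mx d] acts on graded forms as [1], being a derivation up to the shift in
   [d k = (d i + d j).+1]. *)
Lemma pi_forms_depth (b : R) : pi_forms (b *: diag_mx (\row_k (d k)%:R)) f = b *: f.
Proof.
apply/funext => k; apply/matrixP => i j.
rewrite /pi_forms linearZ/= tr_diag_mx -scalemxAl -scalemxAr mul_diag_mx mul_mx_diag.
rewrite !mxE pushf_entry.
rewrite (bigD1 k)//= big1 ?addr0 => [|l /negbTE lk]; last first.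
  by rewrite !mxE eq_sym lk mulr0n mulr0 mul0r.
rewrite !mxE eqxx mulr1n; have [->|/graded ->] := eqVneq (f k i j) 0.
  by rewrite !(mulr0, mul0r) !subr0.
by rewrite -natr1 natrD; ring.
Qed.

Lemma graded_pi_act : pi_act (Pmx nu) nu = bscale (kappa ^+ 2 / 2) nu.
Proof.
apply: forms_inj; rewrite forms_pi_act forms_bscale; set b := kappa ^+ 2 / 2.
have V_nu : pushf V (forms nu) = pullf V (kappa *: f) by rewrite pullfZ.
have := pi_forms_intertwine V_nu graded_Pmx.
rewrite pi_formsZ pi_forms_depth scalerA [kappa * b]mulrC -scalerA pullfZ -V_nu -pushfZ.
move/(congr1 (pushf (invmx V))); rewrite !pushf_comp mulVmx// !pushf1; exact.
Qed.

Lemma graded_fixed_point : bdot nu nu = 1 -> flow_rhs nu = @bzero R N.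
Proof.
move=> nu1; have alpha_nu : alpha nu = - (kappa ^+ 2 / 2).
  rewrite /alpha graded_pi_act; congr (- _); rewrite -[RHS]mulr1 -nu1 /bdot.
  do 3![rewrite mulr_sumr; apply: eq_bigr => ? _].
  by rewrite mulrA.
apply: forms_inj; apply/funext => k; rewrite forms_flow_rhs forms_bzero -forms_pi_act.
by rewrite graded_pi_act forms_bscale alpha_nu scaleNr opprK addNr.
Qed.

End graded_forms.

(** * The moving frame *)

Section continuity.
Context {R : realType} {N : nat}.
Variable m : R -> bracket R N.
Hypothesis cm : forall i j k, continuous0y (fun t => m t i j k).

Lemma continuous0y_Pmx : continuous0y (fun t => Pmx (m t)).
Proof.
apply/continuous0y_mxP => a b.
apply: (@eq_continuous0y _ _ (fun t => \sum_(i < N) \sum_(j < N | (i < j)%N)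
  m t i j a * m t i j b)) => [t _|]; first by rewrite mxE.
by do 2![apply: continuous0y_sum => ? _]; exact: continuous0yM.
Qed.

Lemma continuous0y_alpha : continuous0y (fun t => alpha (m t)).
Proof.
have /continuous0y_mxP cP := continuous0y_Pmx.
apply: continuous0yN; do 3![apply: continuous0y_sum => ? _].
apply: continuous0yM => //; rewrite /pi_act.
do 2?[apply: continuous0yB]; apply: continuous0y_sum => l _;
  exact: continuous0yM.
Qed.

End continuity.

Section flow.
Context {R : realType} {N : nat}.

Definition bracket_flow (m : R -> bracket R N) :=
  forall k, is_derive0y (fun t => forms (m t) k) (fun t => forms (flow_rhs (m t)) k).

Lemma bracket_flow_intro (m : R -> bracket R N) :
  (forall i j k, m s i j k @[s --> 0^'+] --> m 0 i j k) ->
  (forall t : R, 0 < t -> forall i j k,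
    is_derive t 1 (fun s => m s i j k) (flow_rhs (m t) i j k)) ->
  bracket_flow m.
Proof.
move=> m0 hm k; apply/is_derive0y_mxP => i j.
apply: (@eq_is_derive0y _ _ (fun t => m t i j k) _ (fun t => flow_rhs (m t) i j k)).
- by move=> t _; rewrite mxE.
- by move=> t _; rewrite mxE.
- by apply: is_derive0y_intro => // t /hm; exact.
Qed.

Variable m : R -> bracket R N.
Hypothesis flow_m : bracket_flow m.

Lemma bracket_flow_entry i j k :
  is_derive0y (fun t => m t i j k) (fun t => flow_rhs (m t) i j k).
Proof.
have /is_derive0y_mxP/(_ i j) := flow_m k.
by apply: eq_is_derive0y => t _; rewrite mxE.
Qed.

Lemma bracket_flow_continuous i j k : continuous0y (fun t => m t i j k).
Proof. by have [] := bracket_flow_entry i j k. Qed.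

Lemma bracket_flow_bdot1 (t : R) :
  bdot (m 0) (m 0) = 1 -> 0 <= t -> bdot (m t) (m t) = 1.
Proof.
move=> m01 t0.
have hbdot : is_derive0y (fun t => bdot (m t) (m t) - 1)
    (fun t => - 2 * alpha (m t) * (bdot (m t) (m t) - 1)).
  have h := is_derive0yB (is_derive0y_sum (index_enum 'I_N) (P := xpredT) (fun i _ =>
    is_derive0y_sum (index_enum 'I_N) (P := fun j => (i < j)%N) (fun j _ =>
    is_derive0y_sum (index_enum 'I_N) (P := xpredT) (fun k _ =>
    is_derive0yM (bracket_flow_entry i j k) (bracket_flow_entry i j k)))))
    (is_derive0y_cst (1 : R)).
  apply: is_derive0y_eq h => s _; rewrite subr0.
  transitivity (2 * bdot (flow_rhs (m s)) (m s)); last by rewrite bdot_flow_rhs; ring.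
  rewrite /bdot; do 3![rewrite mulr_sumr; apply: eq_bigr => ? _]; ring.
have c2 : continuous0y (fun t => - 2 * alpha (m t)).
  apply: continuous0yM; first exact: continuous0y_cst.
  exact: continuous0y_alpha bracket_flow_continuous.
by apply/eqP; rewrite -subr_eq0 (linear_ode_expR c2 hbdot t0) m01 subrr mul0r.
Qed.

End flow.

Section frame.
Context {R : realType} {N : nat}.
Variables (m : R -> bracket R N) (g h : R -> 'M[R]_N).
Hypothesis flow_m : bracket_flow m.
Hypothesis flow_g : is_derive0y g (fun t => g t *m Pmx (m t)).
Hypothesis flow_h : is_derive0y h (fun t => - (Pmx (m t) *m h t)).
Hypothesis gh0 : g 0 *m h 0 = 1%:M.

Lemma frame_inverse (t : R) : 0 <= t -> g t *m h t = 1%:M.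
Proof.
move=> t0; rewrite -gh0; apply: (@is_derive0y_mx_0_is_cst _ _ _ (fun t => g t *m h t)) t0.
apply: is_derive0y_eq (is_derive0y_mulmx flow_g flow_h) => s _.
by rewrite mulmxN mulmxA subrr.
Qed.

Lemma frame_inverseC (t : R) : 0 <= t -> h t *m g t = 1%:M.
Proof. by move=> t0; apply: mulmx1C; exact: frame_inverse. Qed.

(* The frame turns the flow into a mere rescaling: the terms coming from [g] and [h]
   cancel [pi (P) m]. *)
Lemma is_derive0y_frame_forms k :
  is_derive0y (fun t => pushf (g t) (pullf (h t) (forms (m t))) k)
    (fun t => - alpha (m t) *: pushf (g t) (pullf (h t) (forms (m t))) k).
Proof.
have /is_derive0y_mxP hg := flow_g.
have dF l := is_derive0y_mulmx
  (is_derive0y_mulmx (is_derive0y_trmx flow_h) (flow_m l)) flow_h.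
have := is_derive0y_sum (index_enum 'I_N) (P := xpredT)
  (fun l _ => is_derive0y_scalemx (hg k l) (dF l)).
apply: is_derive0y_eq => t _.
set P := Pmx (m t); set X := h t; set F := pullf X (forms (m t)).
have dFE l : ((- (P *m X))^T *m forms (m t) l + X^T *m forms (flow_rhs (m t)) l) *m X
    + X^T *m forms (m t) l *m - (P *m X) = - pushf P F l - alpha (m t) *: F l.
  rewrite forms_flow_rhs /pi_forms -/P linearN/= trmx_mul pushf_pullf /F /pullf.
  set M := forms (m t) l; set W := pushf _ _ _.
  rewrite !mulNmx mulmxN !mulmxBr mulmxN !mulmxBr !(mulmxBl, mulmxDl) !mulNmx.
  rewrite -scalemxAr -scalemxAl !mulmxBl !mulmxA.
  by apply/matrixP => i j; rewrite !mxE; ring.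
under eq_bigr do rewrite dFE scalerBr scalerN addrA.
rewrite sumrB big_split/= sumrN.
rewrite -[X in X - _ - _]/(pushf (g t *m P) F k).
rewrite -[X in _ - X - _]/(pushf (g t) (pushf P F) k).
rewrite pushf_comp subrr sub0r scaleNr; congr (- _).
by rewrite scaler_sumr; apply: eq_bigr => l _; rewrite !scalerA mulrC.
Qed.

Variables (r : R) (f : 'I_N -> 'M[R]_N).
Hypothesis f0 : pushf (g 0) (pullf (h 0) (forms (m 0))) = r *: f.

Definition frame_scale (t : R) : R := r * expR (prim (fun t => - alpha (m t)) t).

Lemma frame_forms (t : R) : 0 <= t ->
  pushf (g t) (forms (m t)) = frame_scale t *: pullf (g t) f.
Proof.
move=> t0; have ca : continuous0y (fun t => - alpha (m t)).
  exact/continuous0yN/continuous0y_alpha/bracket_flow_continuous.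
have gauged : pushf (g t) (pullf (h t) (forms (m t))) = frame_scale t *: f.
  apply/funext => k; apply/matrixP => i j.
  have /is_derive0y_mxP/(_ i j) hF := is_derive0y_frame_forms k.
  rewrite (linear_ode_expR ca (is_derive0y_eq _ hF) t0) => [|s _]; last by rewrite mxE.
  by rewrite f0 !mxE /frame_scale; ring.
by rewrite -pullfZ -gauged -pushf_pullf pullf_comp frame_inverseC// pullf1.
Qed.

Hypothesis skew_f : skewf f.

Lemma frame_bracket_skew (t : R) : 0 <= t -> Defs.skew (m t).
Proof.
move=> t0; apply/skewf_forms; rewrite -[forms _]pushf1 -(frame_inverseC t0).
rewrite -pushf_comp frame_forms//.
exact/skewf_pushf/skewfZ/skewf_pullf.
Qed.

Lemma is_derive0y_frame_gram :
  is_derive0y (fun t => g t *m (g t)^T)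
    (fun t => frame_scale t ^+ 2 *: form_gram f (g t *m (g t)^T)).
Proof.
apply: is_derive0y_eq (is_derive0y_mulmx flow_g (is_derive0y_trmx flow_g)) => t t0.
have t_ge0 := ltW t0; have skew_m := frame_bracket_skew t_ge0.
rewrite trmx_mul tr_Pmx mulmxA -[X in form_gram f X]mul1mx.
transitivity (form_gram (pushf (g t) (forms (m t))) 1%:M).
  rewrite form_gram_pushf Pmx_form_gram// -scalemxAr -scalemxAl -scalerDl.
  by rewrite [2^-1 + _](_ : _ = 1) ?scale1r//; field.
by rewrite frame_forms// form_gramZ form_gram_pullf mulmx1 mul1mx.
Qed.

Lemma det_frame (t : R) : bdot (m 0) (m 0) = 1 -> 0 <= t ->
  \det (g t) = \det (g 0) * expR t.
Proof.
move=> m01 t0; have cP := continuous0y_Pmx (bracket_flow_continuous flow_m).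
rewrite (liouville_det cP flow_g t0).
have ctrP : continuous0y (fun s => \tr (Pmx (m s))).
  by apply: continuous0y_sum => i _; move/continuous0y_mxP: cP; exact.
rewrite (@prim_FTC2 _ id) ?subr0//.
apply: is_derive0y_eq is_derive0y_id => s s0.
by rewrite mxtrace_Pmx (bracket_flow_bdot1 flow_m)// ltW.
Qed.

Definition frame_time : R -> R := prim (fun t => frame_scale t ^+ 2).

Lemma is_derive0y_frame_time :
  is_derive0y frame_time (fun t => frame_scale t ^+ 2).
Proof.
have ca : continuous0y (fun t => - alpha (m t)).
  exact/continuous0yN/continuous0y_alpha/bracket_flow_continuous.
have [cE _] := is_derive0y_comp (@is_derive_expR R) (is_derive0y_prim ca).
have cq : continuous0y frame_scale.
  by apply: continuous0yM cE; exact: continuous0y_cst.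
apply: is_derive0y_prim; exact: continuous0yM.
Qed.

Lemma frame_time_le (t u : R) : 0 <= t -> t <= u -> frame_time t <= frame_time u.
Proof.
move=> t0 tu; apply: (ger0_is_derive0y_le is_derive0y_frame_time) => // s _.
exact: sqr_ge0.
Qed.

(* A polynomial in the new time equals [\det (g 0) ^+ 2 * expR (2 t)]. *)
Lemma frame_time_cvgy (GG : 'M[{poly R}]_N) : bdot (m 0) (m 0) = 1 ->
  (forall t, 0 <= t -> g t *m (g t)^T = evalmx (frame_time t) GG) ->
  frame_time t @[t --> +oo] --> +oo.
Proof.
move=> m01 gramE; have det_gram t : 0 <= t ->
    (\det GG).[frame_time t] = (\det (g 0) * expR t) ^+ 2.
  move=> t0; rewrite -[LHS]/(horner_eval (frame_time t) (\det GG)) -det_map_mx.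
  by rewrite -[map_mx _ _]/(evalmx _ _) -gramE// det_mulmx det_tr (det_frame m01 t0).
have det0 : \det (g 0) != 0.
  by rewrite -unitfE -unitmxE; have /mulmx1_unit[] := gh0.
apply/cvgryPge => M; have [ub detGG] := poly_disk_bound (\det GG) `|M|.
pose T := `|ub| / \det (g 0) ^+ 2.
near=> t; have t0 : 0 <= t by near: t; exact: nbhs_pinfty_ge.
rewrite leNgt; apply/negP => tM.
have time0 : 0 <= frame_time t.
  by rewrite -(prim0 (fun t => frame_scale t ^+ 2)) frame_time_le.
have time_le : `|frame_time t| <= `|M|.
  by rewrite ger0_norm// (le_trans (ltW tM))// ler_norm.
have := detGG _ time_le; rewrite det_gram// ger0_norm ?sqr_ge0// leNgt => /negP; apply.
have tT : T < t by near: t; apply: nbhs_pinfty_gt; exact: num_real.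
rewrite exprMn mulrC -ltr_pdivrMr ?exprn_even_gt0//.
apply: (@le_lt_trans _ _ T); first by rewrite ler_wpM2r ?invr_ge0 ?sqr_ge0 ?ler_norm.
apply: lt_le_trans tT _; apply: le_trans (_ : 1 + t <= _); first by rewrite lerDr.
apply: le_trans (expR_ge1Dx t) _.
by rewrite expr2 ler_peMr ?expR_ge0// -[leLHS]expR0 ler_expR.
Unshelve. all: by end_near. Qed.

End frame.

(** * Convergence along a subsequence *)

Section subsequences.
Context {R : realType}.

Lemma increasing_seq_cvg (phi : nat -> nat) :
  increasing_seq phi -> phi n @[n --> \oo] --> \oo.
Proof.
move=> /increasing_seqP iphi; have phi_ge n : (n <= phi n)%N.
  by elim: n => // n ih; apply: leq_ltn_trans ih (iphi n).
apply/cvgnyPge => A; near=> n; apply: leq_trans (phi_ge n).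
by near: n; exact: nbhs_infty_ge.
Unshelve. all: by end_near. Qed.

Lemma bolzano_weierstrass_family (I : finType) (f : I -> nat -> R) :
  (forall i, bounded_fun (f i)) ->
  exists2 phi : nat -> nat, increasing_seq phi & forall i, cvgn (f i \o phi).
Proof.
move=> bf.
suff [phi iphi cphi] : exists2 phi : nat -> nat, increasing_seq phi &
    forall i, i \in enum I -> cvgn (f i \o phi).
  by exists phi => // i; apply: cphi; rewrite mem_enum.
elim: (enum I) => [|i r [phi iphi cphi]]; first by exists id.
have [|psi ipsi cpsi] := @bolzano_weierstrass R (f i \o phi).
  have [B [Breal fB]] := bf i; exists B; split=> // x Bx n _.
  exact: fB.
exists (phi \o psi); first by move=> x y; exact: etrans (iphi _ _) (ipsi _ _).
move=> j; rewrite inE => /predU1P[->//|/cphi cj].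
exact: cvgP (cvg_comp _ _ (increasing_seq_cvg ipsi) cj).
Qed.

Lemma cvg_colinear {T : Type} (F : set_system T) {FF : ProperFilter F} (p n : nat)
    (a : T -> R) (x y : T -> 'I_p -> 'M[R]_n) (xlim ylim : 'I_p -> 'M[R]_n) :
  (forall k, x t k @[t --> F] --> xlim k) -> (forall k, y t k @[t --> F] --> ylim k) ->
  (\forall t \near F, x t = a t *: y t) -> ylim <> 0 ->
  exists kappa : R, xlim = kappa *: ylim.
Proof.
move=> hx hy xay ylim0.
have [k [i [j yn0]]] : exists k i j, ylim k i j != 0.
  apply: contrapT => /forallNP ylimP; apply: ylim0; apply/funext => k.
  apply/matrixP => i j; rewrite mxE; apply/eqP; apply: contrapT => /negP yn0.
  by apply: (ylimP k); exists i, j.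
have entry (z : T -> 'I_p -> 'M[R]_n) (zlim : 'I_p -> 'M[R]_n) :
    (forall k, z t k @[t --> F] --> zlim k) ->
    forall k i j, z t k i j @[t --> F] --> zlim k i j.
  by move=> hz k' i' j'; have /cvg_mxP := hz k'; exact.
have a_cvg : a t @[t --> F] --> xlim k i j / ylim k i j.
  have xy : x t k i j / y t k i j @[t --> F] --> xlim k i j / ylim k i j.
    by apply: cvgM; [exact: entry|apply: cvgV yn0 _; exact: entry].
  have yn : \forall t \near F, y t k i j != 0 by exact: cvgr_neq0 (entry _ _ hy k i j) yn0.
  apply: cvg_trans xy; apply: near_eq_cvg; near=> t.
  have -> : x t = a t *: y t by near: t.
  by rewrite mxE mulfK//; near: t.
exists (xlim k i j / ylim k i j); apply/funext => k'; apply/matrixP => i' j'.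
have ay : a t * y t k' i' j' @[t --> F] --> xlim k i j / ylim k i j * ylim k' i' j'.
  by apply: cvgM => //; exact: entry.
apply: (cvg_unique (@norm_hausdorff _ _) (entry _ _ hx k' i' j')).
rewrite mxE; apply: cvg_trans ay; apply: near_eq_cvg; near=> t.
have -> : x t = a t *: y t by near: t.
by rewrite mxE.
Unshelve. all: by end_near. Qed.

End subsequences.

Section rescaled_limit.
Context {R : realType} {N : nat}.
Variables (d : 'I_N -> nat) (f : 'I_N -> 'M[R]_N) (GG : 'M[{poly R}]_N).
Hypothesis superadd : depth_superadditive d f.
Hypothesis generated : generated_by_depth0 d (graded_part d f).
Hypothesis f_neq0 : f <> 0.
Hypothesis GG_flow : map_mx (deriv (R := R)) GG = form_gram (poly_forms f) GG.
Hypothesis GG_size : forall k l, (size (GG k l) <= (minn (d k) (d l)).+1)%N.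

Lemma graded_part_depth i j k : graded_part d f k i j != 0 -> d k = (d i + d j).+1.
Proof. by rewrite mxE; have [|_] := eqVneq (d k) _; rewrite ?eqxx. Qed.

Lemma limit_frame_unit (V g0 : 'M[R]_N) : g0 \in unitmx ->
  evalmx 0 GG = g0 *m g0^T -> V *m V^T = limit_gram d GG -> V \in unitmx.
Proof.
move=> g0_unit GG0 VL; rewrite -row_free_unit -kermx_eq0; apply/rowV0P => x.
move=> /sub_kermxP.
apply: (graded_kernel_trivial graded_part_depth (D := diag_mx (\row_k (d k)%:R))).
- by rewrite VL; exact: form_gram_limit_gram.
- exact: generated.
- move=> {}x x0 xV; have : x *m g0 = 0.
    apply: row_gram_eq0; rewrite -GG0 -(depth0_limit_gram GG x0) -VL.
    by rewrite mulmxA xV !mul0mx.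
  by move=> /(congr1 (mulmx^~ (invmx g0))); rewrite mulmxK// mul0mx.
Qed.

Lemma graded_part_neq0 (V : 'M[R]_N) : V \in unitmx -> V *m V^T = limit_gram d GG ->
  graded_part d f <> 0.
Proof.
move=> V_unit VL gr0; apply: f_neq0; apply/funext => k; apply/matrixP => i j.
rewrite mxE; apply/eqP; apply: contraT => /superadd.
have L_unit : limit_gram d GG \in unitmx by rewrite -VL unitmx_mul unitmx_tr V_unit.
have := form_gram_limit_gram superadd GG_size GG_flow.
have -> : form_gram (graded_part d f) (limit_gram d GG) = 0.
  by rewrite gr0 -(scale0r (0 : 'I_N -> 'M[R]_N)) form_gramZ expr0n scale0r.
move=> /(congr1 (mulmx^~ (invmx (limit_gram d GG)))); rewrite mulmxK// mul0mx.
move=> /matrixP/(_ k k)/esym/eqP; rewrite !mxE eqxx mulr1n pnatr_eq0 => /eqP ->.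
by rewrite ltn0.
Qed.

Variables (m : R -> bracket R N) (g : R -> 'M[R]_N) (q s : R -> R).
Hypothesis bdot1_m : forall t, 0 <= t -> bdot (m t) (m t) = 1.
Hypothesis skew_m : forall t, 0 <= t -> Defs.skew (m t).
Hypothesis frame_m :
  forall t, 0 <= t -> pushf (g t) (forms (m t)) = q t *: pullf (g t) f.
Hypothesis gram_g : forall t, 0 <= t -> g t *m (g t)^T = evalmx (s t) GG.
Hypothesis g0_unit : g 0 \in unitmx.
Hypothesis s0 : s 0 = 0.
Hypothesis s_cvgy : s t @[t --> +oo] --> +oo.

Definition frame_ratio (t : R) : R := (Num.sqrt (s t))^-1.

Definition scaled_frame (t : R) : 'M[R]_N := depth_scale d (frame_ratio t) *m g t.

Lemma cvg_frame_ratio : frame_ratio t @[t --> +oo] --> 0^'.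
Proof.
have ratio_le e : 0 < e -> \forall t \near +oo, 0 < frame_ratio t < e.
  move=> e0; near=> t; have st : e^-1 ^+ 2 < s t.
    by near: t; move/cvgryPgt: s_cvgy; exact.
  have st0 : 0 < s t by apply: le_lt_trans st; exact: sqr_ge0.
  rewrite /frame_ratio invr_gt0 sqrtr_gt0 st0 -[ltRHS]invrK.
  rewrite ltf_pV2 ?posrE ?invr_gt0 ?sqrtr_gt0//.
  by rewrite -(@ltr_pXn2r _ 2) ?nnegrE ?invr_ge0 ?sqrtr_ge0 ?ltW// sqr_sqrtr// ltW.
move=> A [e /= e0 eA]; apply: filterS (ratio_le e e0) => t /andP[t0 te].
by apply: eA; rewrite ?gt_eqF//= sub0r normrN gtr0_norm.
Unshelve. all: by end_near. Qed.

Lemma cvg_scaled_frame_gram :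
  scaled_frame t *m (scaled_frame t)^T @[t --> +oo] --> limit_gram d GG.
Proof.
apply: cvg_trans (cvg_comp _ _ cvg_frame_ratio (cvg_limit_gram GG_size)).
apply: near_eq_cvg; near=> t; have t0 : 0 <= t by near: t; exact: nbhs_pinfty_ge.
have st : 0 < s t by near: t; move/cvgryPgt: s_cvgy; exact.
rewrite /= /scaled_frame trmx_mul tr_depth_scale !mulmxA -[_ *m g t *m _]mulmxA gram_g//.
by rewrite invrK sqr_sqrtr ?ltW.
Unshelve. all: by end_near. Qed.

Lemma scaled_frame_entry_bounded i j : bounded_fun (fun n : nat => scaled_frame n%:R i j).
Proof.
have gram_cvg : scaled_frame n%:R *m (scaled_frame n%:R)^T @[n --> \oo] --> limit_gram d GG.
  exact: cvg_comp (@cvgr_idn R) cvg_scaled_frame_gram.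
have [B [Breal gramB]] := cvg_seq_bounded (cvgP _ gram_cvg).
exists (1 + B); split=> [|x Bx n _ /=]; first by rewrite num_real.
have B1x : B < x - 1 by rewrite ltrBrDl.
have sqr_le : `|scaled_frame n%:R i j| ^+ 2 <= x - 1.
  rewrite real_normK ?num_real// (le_trans (sqr_entry_le_gram _ _ _))//.
  rewrite (le_trans (ler_norm _))// (le_trans (le_mx_norm _ _ _))//.
  exact: gramB _ B1x n I.
by have := sqr_ge0 (`|scaled_frame n%:R i j| - 2^-1); nra.
Qed.

Lemma scaled_frame_forms (t : R) : 0 <= t ->
  pushf (scaled_frame t) (forms (m t)) =
  (q t * frame_ratio t) *: pullf (scaled_frame t) (rescaled_forms d f (frame_ratio t)).
Proof.
move=> t0; rewrite -pushf_comp frame_m// pushfZ pushf_pullf pushf_depth_scale//.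
by rewrite pullfZ scalerA pullf_comp.
Qed.

Lemma bracket_entry_bounded i j k : bounded_fun (fun n : nat => m n%:R i j k).
Proof.
exists 1; split=> [|x /ltW x1 n _ /=]; first exact: num_real.
apply: le_trans x1; rewrite -(@ler_pXn2r _ 2) ?nnegrE// expr1n real_normK ?num_real//.
by rewrite (le_trans (sqr_entry_le_bdot i j k (skew_m _)))// bdot1_m.
Qed.

Lemma limit_point_exists : exists (phi : nat -> nat) (V : 'M[R]_N) (nu : bracket R N),
  [/\ increasing_seq phi, scaled_frame (phi n)%:R @[n --> \oo] --> V &
      forall i j k, m (phi n)%:R i j k @[n --> \oo] --> nu i j k].
Proof.
pose u (x : ('I_N * 'I_N * 'I_N) + ('I_N * 'I_N)) (n : nat) : R :=
  match x with inl (i, j, k) => m n%:R i j k | inr (i, j) => scaled_frame n%:R i j end.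
have [phi iphi cphi] : exists2 phi : nat -> nat, increasing_seq phi &
    forall x, cvgn (u x \o phi).
  apply: bolzano_weierstrass_family => -[[[i j] k]|[i j]].
  - exact: bracket_entry_bounded.
  - exact: scaled_frame_entry_bounded.
exists phi, (\matrix_(i, j) limn (u (inr (i, j)) \o phi)),
  (fun i j k => limn (u (inl (i, j, k)) \o phi)); split=> //.
- by apply/cvg_mxP => i j; rewrite mxE; exact: (cphi (inr (i, j))).
- by move=> i j k; exact: (cphi (inl (i, j, k))).
Qed.

Variables (tn : nat -> R) (V : 'M[R]_N) (nu : bracket R N).
Hypothesis tn_ge0 : forall n, 0 <= tn n.
Hypothesis tn_cvgy : tn n @[n --> \oo] --> +oo.
Hypothesis V_lim : scaled_frame (tn n) @[n --> \oo] --> V.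
Hypothesis nu_lim : forall i j k, m (tn n) i j k @[n --> \oo] --> nu i j k.

Lemma limit_point_gram : V *m V^T = limit_gram d GG.
Proof.
apply: (cvg_unique (@norm_hausdorff _ _) (cvg_mulmx V_lim (cvg_trmx V_lim))).
exact: (cvg_comp _ _ tn_cvgy cvg_scaled_frame_gram).
Qed.

Lemma limit_point_bdot1 : bdot nu nu = 1.
Proof.
have nu_bdot : bdot (m (tn n)) (m (tn n)) @[n --> \oo] --> bdot nu nu.
  by do 3![apply: cvg_sum => ? _]; apply: cvgM; exact: nu_lim.
apply: (cvg_unique (@Rhausdorff R) nu_bdot).
by apply: cvg_near_cst; apply: nearW => n; exact: bdot1_m.
Qed.

Lemma limit_point_skew : Defs.skew nu.
Proof.
move=> i j k.
have skew_lim : m (tn n) i j k @[n --> \oo] --> - nu j i k.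
  have -> : (fun n => m (tn n) i j k) = (fun n => - m (tn n) j i k).
    by apply/funext => n; rewrite skew_m.
  by apply: cvgN; exact: nu_lim.
exact: (cvg_unique (@Rhausdorff R) (@nu_lim i j k) skew_lim).
Qed.

Lemma limit_point_graded : exists kappa : R,
  pushf V (forms nu) = kappa *: pullf V (graded_part d f).
Proof.
have V_unit : V \in unitmx.
  by apply: limit_frame_unit g0_unit _ limit_point_gram; rewrite gram_g ?s0.
have forms_lim k : forms (m (tn n)) k @[n --> \oo] --> forms nu k.
  by apply/cvg_mxP => i j; rewrite mxE; under eq_cvg do rewrite mxE; exact: nu_lim.
have ratio_lim : frame_ratio (tn n) @[n --> \oo] --> 0.
  apply: cvg_trans (cvg_comp _ _ tn_cvgy cvg_frame_ratio) _.
  exact: cvg_within.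
have rescaled_lim k :
    rescaled_forms d f (frame_ratio (tn n)) k @[n --> \oo] --> graded_part d f k.
  exact: cvg_comp ratio_lim (cvg_rescaled_forms superadd (k := k)).
apply: (cvg_colinear (cvg_pushf V_lim forms_lim) (cvg_pullf V_lim rescaled_lim)
  (a := fun n => q (tn n) * frame_ratio (tn n))).
- by apply: nearW => n; exact: scaled_frame_forms.
- move=> Vgr0; apply: (graded_part_neq0 V_unit limit_point_gram).
  rewrite -[graded_part d f]pullf1 -(mulmxV V_unit) -pullf_comp Vgr0.
  by apply/funext => k; rewrite /pullf mulmx0 mul0mx.
Qed.

Lemma limit_point_fixed : flow_rhs nu = @bzero R N.
Proof.
have [kappa nu_graded] := limit_point_graded.
apply: (graded_fixed_point graded_part_depth _ limit_point_skew _ nu_graded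
  limit_point_bdot1).
  by apply: limit_frame_unit g0_unit _ limit_point_gram; rewrite gram_g ?s0.
by rewrite limit_point_gram; exact: form_gram_limit_gram.
Qed.

End rescaled_limit.

Section nilpotent_flow.
Context {R : realType} {N : nat}.
Variable m : R -> bracket R N.
Hypothesis flow_m : bracket_flow m.

Lemma moving_frame_exists (g0 h0 : 'M[R]_N) : exists g h : R -> 'M[R]_N,
  [/\ g 0 = g0, h 0 = h0, is_derive0y g (fun t => g t *m Pmx (m t)) &
      is_derive0y h (fun t => - (Pmx (m t) *m h t))].
Proof.
have cP := continuous0y_Pmx (bracket_flow_continuous flow_m).
have [X X0 hX] := linear_ode_exists g0^T cP.
have [h h00 hh] := linear_ode_exists h0 (continuous0yN cP).
exists (fun t => (X t)^T), h; split=> //; first by rewrite X0 trmxK.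
  by apply: is_derive0y_eq (is_derive0y_trmx hX) => t _; rewrite trmx_mul tr_Pmx.
by apply: is_derive0y_eq hh => t _; rewrite mulNmx.
Qed.

Lemma adapted_forms_neq0 (r : R) (mu : bracket R N) (B : 'M[R]_N) :
  B \in unitmx -> m 0 = bscale r mu -> bdot (m 0) (m 0) = 1 -> adapted_forms mu B <> 0.
Proof.
move=> B_unit m0 bdot1 f0; have : forms mu = 0.
  have BTV : B^T *m (invmx B)^T = 1%:M by rewrite -trmx_mul mulVmx ?trmx1.
  rewrite -[forms mu]pushf1 -BTV -pushf_comp -[pushf _ (forms mu)]pullf1 -BTV.
  rewrite -pullf_comp -[pullf B^T _]pushf_pullf.
  rewrite -[pushf _ (pullf B^T _)]/(adapted_forms mu B) f0.
  apply/funext => k; rewrite /pushf big1// => l _.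
  by rewrite /pullf mulmx0 mul0mx scaler0.
rewrite -forms_bzero => /forms_inj mu0; move: bdot1.
by rewrite m0 mu0 bdot_bscale bdot_bzero mulr0 => /eqP; rewrite eq_sym oner_eq0.
Qed.

Theorem nilpotent_flow_subconverges (r : R) (mu : bracket R N) :
  Defs.skew mu -> jacobi mu -> nilpotent mu ->
  m 0 = bscale r mu -> bdot (m 0) (m 0) = 1 ->
  exists phi : nat -> nat, increasing_seq phi /\
    exists nu : bracket R N, [/\ bdot nu nu = 1, flow_rhs nu = @bzero R N &
      forall i j k, m (phi n)%:R i j k @[n --> \oo] --> nu i j k].
Proof.
move=> sk ja ni m0 bdot1.
have [B [d [B_unit superadd gen]]] := adapted_basis_exists sk ja ni.
have [g [h [g0 h0 hg hh]]] := moving_frame_exists (invmx B)^T B^T.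
have gh0 : g 0 *m h 0 = 1%:M by rewrite g0 h0 -trmx_mul mulmxV ?trmx1.
set f := adapted_forms mu B in superadd gen.
have f0 : pushf (g 0) (pullf (h 0) (forms (m 0))) = r *: f.
  by rewrite g0 h0 m0 forms_bscale pullfZ pushfZ.
have skew_f : skewf f by apply/skewf_pushf/skewf_pullf/skewf_forms.
have [GG [GG0 dGG sGG]] := gram_poly_exists superadd (g 0 *m (g 0)^T).
pose q := frame_scale m r; pose s := frame_time m r.
have s0 : s 0 = 0 by exact: prim0.
have gramE t : 0 <= t -> g t *m (g t)^T = evalmx (s t) GG.
  exact: (form_gram_flow_unique superadd dGG GG0 s0 (is_derive0y_frame_time flow_m r)
    (is_derive0y_frame_gram flow_m hg hh gh0 f0 skew_f)).
have s_cvgy := frame_time_cvgy flow_m hg gh0 bdot1 gramE.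
have bdot1_m t : 0 <= t -> bdot (m t) (m t) = 1 by exact: bracket_flow_bdot1.
have skew_m t : 0 <= t -> Defs.skew (m t).
  exact: (frame_bracket_skew flow_m hg hh gh0 f0 skew_f).
have frame t : 0 <= t -> pushf (g t) (forms (m t)) = q t *: pullf (g t) f.
  exact: (frame_forms flow_m hg hh gh0 f0).
have [phi [V [nu [iphi V_lim nu_lim]]]] :=
  limit_point_exists sGG bdot1_m skew_m gramE s_cvgy.
exists phi; split=> //; exists nu.
have tn_ge0 n : 0 <= (phi n)%:R :> R by [].
have tn_cvgy : (phi n)%:R @[n --> \oo] --> (+oo : set_system R).
  exact: cvg_comp (increasing_seq_cvg iphi) (@cvgr_idn R).
split=> //; first exact: (limit_point_bdot1 bdot1_m tn_ge0 nu_lim).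
have g0_unit : g 0 \in unitmx by have /mulmx1_unit[] := gh0.
have f_neq0 := adapted_forms_neq0 B_unit m0 bdot1.
exact: (limit_point_fixed superadd gen f_neq0 dGG sGG bdot1_m skew_m frame gramE
  g0_unit s0 s_cvgy tn_ge0 tn_cvgy V_lim nu_lim).
Qed.

End nilpotent_flow.

Unset Implicit Arguments.

Theorem theorem3p14 (R : realType) (n : nat) (J : 'M[R]_(2 * n))
    (mu : bracket R (2 * n)) (mut : R -> bracket R (2 * n)) :
  J *m J = - 1%:M ->
  J^T *m J = 1%:M ->
  in_C J mu ->
  nilpotent mu ->
  mu <> @bzero R (2 * n)%N ->
  mut 0 = bscale (bnorm mu)^-1 mu ->
  (forall i j k, mut s i j k @[s --> 0^'+] --> mut 0 i j k) ->
  (forall t : R, 0 < t -> forall i j k,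
      is_derive t 1 (fun s => mut s i j k) (flow_rhs (mut t) i j k)) ->
  exists tl : nat -> R,
    [/\ (forall l, tl l < tl l.+1),
        tl @ \oo --> +oo &
        exists nu : bracket R (2 * n),
          [/\ nu <> @bzero R (2 * n)%N,
              flow_rhs nu = @bzero R (2 * n)%N &
              forall i j k, mut (tl l) i j k @[l --> \oo] --> nu i j k]].
Proof.
move=> _ _ [sk ja _] ni mu0 mut0 mut_right flow_mut.
have bdot1 : bdot (mut 0) (mut 0) = 1 by rewrite mut0; exact: bdot_normalize.
have [phi [iphi [nu [nu1 nu_fixed nu_lim]]]] :=
  nilpotent_flow_subconverges (bracket_flow_intro mut_right flow_mut) sk ja ni mut0 bdot1.
exists (fun l => (phi l)%:R); split.
- by move=> l; rewrite ltr_nat; move/increasing_seqP: iphi; exact.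
- exact: cvg_comp (increasing_seq_cvg iphi) (@cvgr_idn R).
- exists nu; split=> // nu0; move/eqP: nu1.
  by rewrite nu0 bdot_bzero eq_sym oner_eq0.
Qed.
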